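(* Let $\mathbf{A}\in\mathbb{R}^{n\times d}$ have rank $r$ and let $\epsilon\in(0,1/2]$. Run Algorithm 1 (defined in the context) on $\mathbf{A}$ and $\epsilon$. Then, with high probability, the output $\widetilde{\mathbf{A}}_n$ is a $(1\pm\epsilon)$-spectral approximation for $\mathbf{A}$ and has $\mathrm{O}\left((r\log\mu(\mathbf{A})+r+\log d)\,\epsilon^{-2}\log d\right)$ rows.
   Context: For a matrix $\mathbf{A}\in\mathbb{R}^{n\times d}$, $\mathbf{a}_i^\top$ denotes its $i$-th row, $\mathbf{A}_i$ the matrix formed by its first $i$ rows, and $\mathbf{M}^+$ the Moore–Penrose pseudo-inverse. $\widetilde{\mathbf{A}}$ is a $(1\pm\epsilon)$-spectral approximation for $\mathbf{A}$ if $(1-\epsilon)\mathbf{A}^\top\mathbf{A}\preceq\widetilde{\mathbf{A}}^\top\widetilde{\mathbf{A}}\preceq(1+\epsilon)\mathbf{A}^\top\mathbf{A}$ (Loewner order). ''With high probability'' means with probability at least $1-1/\mathrm{poly}(d)$. $\mu(\mathbf{A})=\|\mathbf{A}\|_2^2/\min_{i}\sigma_{\min}(\mathbf{A}_i)^2$, where $\sigma_{\min}$ is the smallest nonzero singular value and the minimum is over $i$ with $\mathbf{A}_i\neq\mathbf{O}$. For a matrix $\mathbf{B}$ with $d$ columns (possibly the zero matrix), the relative leverage score is $\tau_i^{\mathbf{B}}(\mathbf{A})=\mathbf{a}_i^\top\left(\mathbf{B}^\top\mathbf{B}+\mathbf{a}_i\mathbf{a}_i^\top\right)^+\mathbf{a}_i$.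 Algorithm 1: set $c=3\epsilon^{-2}\log d$ (natural log) and $\widetilde{\mathbf{A}}_0=\mathbf{O}$. For $i=1,\dots,n$ (rows arriving online): $\tilde l_i=\min((1+\epsilon)\tau_i^{\widetilde{\mathbf{A}}_{i-1}}(\mathbf{A}),1)$, $p_i=\min(c\tilde l_i,1)$, and, using fresh independent randomness, with probability $p_i$ set $\widetilde{\mathbf{A}}_i$ to $\widetilde{\mathbf{A}}_{i-1}$ with the row $\mathbf{a}_i^\top/\sqrt{p_i}$ appended, otherwise $\widetilde{\mathbf{A}}_i=\widetilde{\mathbf{A}}_{i-1}$. Output $\widetilde{\mathbf{A}}_n$. *)

(* Defs.v *)
(* Stdlib (classical reals R, with ln, sqrt).  Matrices are represented
   as functions nat -> nat -> R together with explicit dimensions; every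
   definition below only reads entries inside the stated dimensions. *)
From Stdlib Require Import Reals List ClassicalEpsilon.
Import ListNotations.
Open Scope R_scope.

Definition vec := nat -> R.
Definition mat := nat -> nat -> R.

Fixpoint sumR (n : nat) (f : nat -> R) : R :=
  match n with O => 0 | S k => sumR k f + f k end.

Lemma inhR : inhabited R. Proof. exact (inhabits 0). Qed.
Lemma inhMat : inhabited mat. Proof. exact (inhabits (fun _ _ => 0)). Qed.

Definition dot (d : nat) (x y : vec) : R := sumR d (fun j => x j * y j).
Definition vnorm (d : nat) (x : vec) : R := sqrt (dot d x x).
Definition mat_apply (d : nat) (A : mat) (x : vec) : vec :=
  fun i => sumR d (fun j => A i j * x j).
Definition quad (d : nat) (M : mat) (x : vec) : R := dot d x (mat_apply d M x).
Definition matmul (d : nat) (X Y : mat) : mat :=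
  fun i j => sumR d (fun k => X i k * Y k j).
Definition transp (X : mat) : mat := fun i j => X j i.
Definition madd (X Y : mat) : mat := fun i j => X i j + Y i j.
Definition mscale (c : R) (X : mat) : mat := fun i j => c * X i j.
Definition vscale (c : R) (x : vec) : vec := fun j => c * x j.
Definition outer (a : vec) : mat := fun i j => a i * a j.
Definition mat_eq (d : nat) (X Y : mat) : Prop :=
  forall i j, (i < d)%nat -> (j < d)%nat -> X i j = Y i j.

Definition row (A : mat) (i : nat) : vec := fun j => A i j.
Definition mat_of_rows (L : list vec) : mat :=
  fun i j => nth i L (fun _ => 0) j.
Definition gram (k : nat) (M : mat) : mat :=
  fun j l => sumR k (fun i => M i j * M i l).
Definition gramL (L : list vec) : mat := gram (length L) (mat_of_rows L).

Definition is_pinv (d : nat) (M X : mat) : Prop :=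
  mat_eq d (matmul d (matmul d M X) M) M /\
  mat_eq d (matmul d (matmul d X M) X) X /\
  mat_eq d (transp (matmul d M X)) (matmul d M X) /\
  mat_eq d (transp (matmul d X M)) (matmul d X M).
Definition pinv (d : nat) (M : mat) : mat := epsilon inhMat (is_pinv d M).

Definition loewner_le (d : nat) (X Y : mat) : Prop :=
  forall x : vec, quad d X x <= quad d Y x.

Definition spectral_approx (n d : nat) (A : mat) (At : list vec) (eps : R) : Prop :=
  loewner_le d (mscale (1 - eps) (gram n A)) (gramL At) /\
  loewner_le d (gramL At) (mscale (1 + eps) (gram n A)).

Definition rows_indep (d : nat) (A : mat) (I : list nat) : Prop :=
  forall c : nat -> R,
    (forall j, (j < d)%nat -> fold_right Rplus 0 (map (fun i => c i * A i j) I) = 0) ->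
    forall i, In i I -> c i = 0.
Definition is_rank (n d : nat) (A : mat) (r : nat) : Prop :=
  (exists I : list nat, NoDup I /\ length I = r /\ Forall (fun i => (i < n)%nat) I /\
                        rows_indep d A I) /\
  (forall I : list nat, NoDup I -> length I = S r -> Forall (fun i => (i < n)%nat) I ->
                        ~ rows_indep d A I).

Definition opnorm (n d : nat) (A : mat) : R :=
  epsilon inhR (is_lub (fun y => exists x : vec, vnorm d x = 1 /\
                                   y = vnorm n (mat_apply d A x))).
Definition is_eigenvalue (d : nat) (G : mat) (l : R) : Prop :=
  exists x : vec, (exists j, (j < d)%nat /\ x j <> 0) /\
    forall j, (j < d)%nat -> mat_apply d G x j = l * x j.
Definition is_singular_value (k d : nat) (M : mat) (s : R) : Prop :=
  0 <= s /\ is_eigenvalue d (gram k M) (s ^ 2).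
Definition sigma_min (k d : nat) (M : mat) : R :=
  epsilon inhR (fun s => is_singular_value k d M s /\ s <> 0 /\
     forall s', is_singular_value k d M s' -> s' <> 0 -> s <= s').
Definition prefix_nonzero (i d : nat) (A : mat) : Prop :=
  exists j k, (j < i)%nat /\ (k < d)%nat /\ A j k <> 0.
Definition min_prefix_sigma2 (n d : nat) (A : mat) : R :=
  epsilon inhR (fun m =>
    (exists i, (1 <= i <= n)%nat /\ prefix_nonzero i d A /\ m = sigma_min i d A ^ 2) /\
    (forall i, (1 <= i <= n)%nat -> prefix_nonzero i d A -> m <= sigma_min i d A ^ 2)).
Definition mu (n d : nat) (A : mat) : R := opnorm n d A ^ 2 / min_prefix_sigma2 n d A.

Definition lev_score (d : nat) (S : list vec) (a : vec) : R :=
  quad d (pinv d (madd (gramL S) (outer a))) a.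
Definition c_param (d : nat) (eps : R) : R := 3 * / (eps ^ 2) * ln (INR d).
Definition samp_prob (d : nat) (eps : R) (S : list vec) (a : vec) : R :=
  Rmin (c_param d eps * Rmin ((1 + eps) * lev_score d S a) 1) 1.

(* Run of Algorithm 1 from row i with current sample S on the coin outcomes bs
   (true = row kept).  Returns the output (list of rows of A~) together with the
   probability of this sequence of coin outcomes. *)
Fixpoint alg_run (d : nat) (eps : R) (A : mat) (i : nat) (Smp : list vec)
         (bs : list bool) : list vec * R :=
  match bs with
  | nil => (Smp, 1)
  | b :: bs' =>
      let p := samp_prob d eps Smp (row A i) in
      let S' := if b then Smp ++ [vscale (/ sqrt p) (row A i)] else Smp in
      let res := alg_run d eps A (Datatypes.S i) S' bs' in
      (fst res, (if b then p else 1 - p) * snd res)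
  end.

Fixpoint all_bools (n : nat) : list (list bool) :=
  match n with
  | O => [nil]
  | S k => map (cons true) (all_bools k) ++ map (cons false) (all_bools k)
  end.

Definition indicator (P : Prop) : R :=
  if excluded_middle_informative P then 1 else 0.

Definition alg_prob (n d : nat) (A : mat) (eps : R) (E : list vec -> Prop) : R :=
  fold_right Rplus 0
    (map (fun bs => let res := alg_run d eps A 0 nil bs in
                    snd res * indicator (E (fst res)))
         (all_bools n)).

(* Main.v *)
Require Import Defs.
From Stdlib Require Import Reals List ClassicalEpsilon.
From mathcomp Require Import all_boot all_order all_algebra.
From mathcomp Require Import complex Rstruct ring lra.
Set Implicit Arguments. Unset Strict Implicit. Unset Printing Implicit Defensive.
Import Order.TTheory GRing.Theory Num.Theory.
Local Open Scope ring_scope.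

(* Without this, arguments of functions on [R] would be parsed in [R_scope]. *)
Bind Scope ring_scope with R.
Arguments exp _%_ring_scope.
Arguments ln _%_ring_scope.

(** Write [G = A^T A], [G_i] for the Gram matrix of the first [i] rows and [G_S]
    for that of the current sample.

    Spectral guarantee.  Choose [T] putting the rows in isotropic position,
    [u_i = T^T a_i].  While [G_i - eps G <= G_S <= G_i + eps G], Cauchy-Schwarz
    gives [p_i >= min (c |u_i|^2, 1)].  For [sg = 1, -1] consider
    [U = 1 + (sg theta T^T (G_S - G_i) T - xi T^T G_i T) / N], with [N] a large
    power of two, and the potential [tr U^N], a polynomial substitute for the
    trace exponential.  A step changes [U] by a multiple of [u_i u_i^T], and for
    rank-one changes the trace of the power grows at most like the scalar
    exponential (log-convexity of the moments [u^T U^j u]; no Golden-Thompson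
    inequality is needed), so the potential is a supermartingale.  It starts at
    [2 d], and as soon as the approximation fails it is at least
    [(1 + 14/25 theta eps / N)^N >= d^(21/20)].

    Number of rows.  Given the spectral guarantee, the bound holds surely.
    Consider [det (l + G_S)] for small [l > 0].  A kept row outside the span of
    the previous ones multiplies it by at least [sigma_min^2 / l]; any other kept
    row multiplies it by at least [1 + 2 / (3 c)], because it is kept only with
    probability at most [3/2 c] times its leverage score.  The final value is at
    most [l^d (1 + 3/2 |A|^2 / l)^q], with [q <= r] the number of rows of the
    first kind, and the powers of [l] cancel. *)

(** * Inner products and eigenvectors of real symmetric matrices *)

Definition ip {F : rcfType} {d} (x y : 'cV[F]_d) : F := \sum_i x i 0 * y i 0.

Lemma ipE (F : rcfType) d (x y : 'cV[F]_d) : ip x y = (x^T *m y) 0 0.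
Proof. by rewrite /ip mxE; apply: eq_bigr => i _; rewrite mxE. Qed.

Lemma ipC (F : rcfType) d (x y : 'cV[F]_d) : ip x y = ip y x.
Proof. by apply: eq_bigr => i _; rewrite mulrC. Qed.

Lemma ipDl (F : rcfType) d (x y z : 'cV[F]_d) : ip (x + y) z = ip x z + ip y z.
Proof. by rewrite /ip -big_split; apply: eq_bigr => i _; rewrite mxE mulrDl. Qed.

Lemma ipDr (F : rcfType) d (x y z : 'cV[F]_d) : ip z (x + y) = ip z x + ip z y.
Proof. by rewrite ipC ipDl !(ipC z). Qed.

Lemma ipZl (F : rcfType) d c (x y : 'cV[F]_d) : ip (c *: x) y = c * ip x y.
Proof. by rewrite /ip mulr_sumr; apply: eq_bigr => i _; rewrite mxE mulrA. Qed.

Lemma ipZr (F : rcfType) d c (x y : 'cV[F]_d) : ip x (c *: y) = c * ip x y.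
Proof. by rewrite ipC ipZl ipC. Qed.

Lemma ip0l (F : rcfType) d (x : 'cV[F]_d) : ip 0 x = 0.
Proof. by rewrite -(scale0r 0) ipZl mul0r. Qed.

Lemma ip0r (F : rcfType) d (x : 'cV[F]_d) : ip x 0 = 0.
Proof. by rewrite ipC ip0l. Qed.

Lemma ipNl (F : rcfType) d (x y : 'cV[F]_d) : ip (- x) y = - ip x y.
Proof. by rewrite -scaleN1r ipZl mulN1r. Qed.

Lemma ipNr (F : rcfType) d (x y : 'cV[F]_d) : ip x (- y) = - ip x y.
Proof. by rewrite ipC ipNl ipC. Qed.

Lemma ipBl (F : rcfType) d (x y z : 'cV[F]_d) : ip (x - y) z = ip x z - ip y z.
Proof. by rewrite ipDl ipNl. Qed.

Lemma ipBr (F : rcfType) d (x y z : 'cV[F]_d) : ip z (x - y) = ip z x - ip z y.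
Proof. by rewrite ipDr ipNr. Qed.

Lemma ip_ge0 (F : rcfType) d (x : 'cV[F]_d) : 0 <= ip x x.
Proof. by apply: sumr_ge0 => i _; rewrite -expr2 sqr_ge0. Qed.

Lemma ip_eq0 (F : rcfType) d (x : 'cV[F]_d) : (ip x x == 0) = (x == 0).
Proof.
apply/idP/eqP => [|->]; last by rewrite ip0l.
rewrite psumr_eq0 => [/allP h|i _]; last by rewrite -expr2 sqr_ge0.
apply/colP => i; rewrite mxE; have := h i (mem_index_enum i).
by rewrite /= mulf_eq0 orbb => /eqP.
Qed.

Lemma ip_gt0 (F : rcfType) d (x : 'cV[F]_d) : (0 < ip x x) = (x != 0).
Proof. by rewrite lt_def ip_ge0 andbT ip_eq0. Qed.

Lemma ip_mull (F : rcfType) m n (M : 'M[F]_(m, n)) x y :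
  ip (M *m x) y = ip x (M^T *m y).
Proof. by rewrite !ipE trmx_mul mulmxA. Qed.

Lemma ip_mulr (F : rcfType) m n (M : 'M[F]_(m, n)) x y :
  ip y (M *m x) = ip (M^T *m y) x.
Proof. by rewrite ip_mull trmxK. Qed.

Lemma ip_delta (F : rcfType) d (x : 'cV[F]_d) k : ip x (delta_mx k 0) = x k 0.
Proof.
rewrite /ip (bigD1 k) //= big1 => [|i ik]; first by rewrite mxE !eqxx mulr1 addr0.
by rewrite mxE (negPf ik) mulr0.
Qed.

Lemma ip_outer (F : rcfType) d (u x y : 'cV[F]_d) : ip x (u *m u^T *m y) = ip x u * ip u y.
Proof.
by rewrite -mulmxA !ipE mulmxA [X in X *m _]mx11_scalar mul_scalar_mx mxE.
Qed.

Lemma outer_mul (F : rcfType) d (u y : 'cV[F]_d) : u *m u^T *m y = ip u y *: u.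
Proof. by rewrite -mulmxA [X in _ *m X]mx11_scalar mul_mx_scalar ipE. Qed.

Lemma trmx_outer (F : rcfType) d (u : 'cV[F]_d) : (u *m u^T)^T = u *m u^T.
Proof. by rewrite trmx_mul trmxK. Qed.

Definition psd {F : rcfType} {d} (M : 'M[F]_d) := forall x, 0 <= ip x (M *m x).

(** The form is nonnegative on the plane spanned by [x] and [y], so its discriminant there has a
    sign. *)
Lemma psd_CS (F : rcfType) d (M : 'M[F]_d) x y : M^T = M -> psd M ->
  (ip x (M *m y)) ^+ 2 <= ip x (M *m x) * ip y (M *m y).
Proof.
move=> sM pM; set a := ip x _; set b := ip x _; set c := ip y _.
have yx : ip y (M *m x) = a by rewrite ip_mulr sM ipC.
have q s t : 0 <= s ^+ 2 * b + 2 * s * t * a + t ^+ 2 * c.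
  have := pM (s *: x + t *: y).
  rewrite mulmxDr -!scalemxAr !(ipDl, ipDr, ipZl, ipZr) yx -/a -/b -/c.
  by congr (0 <= _); ring.
have c0 : 0 <= c by apply: pM.
have [c_gt|] := ltrP 0 c; last first.
  move=> cle; have c00 : c = 0 by apply/eqP; rewrite eq_le cle c0.
  rewrite c00 mulr0; have [->|a0] := eqVneq a 0; first by rewrite expr0n.
  (* This choice gives the form the value [b - (b + 1) = -1]. *)
  have := q 1 (- (b + 1) / (2 * a)); rewrite c00.
  suff -> : 1 ^+ 2 * b + 2 * 1 * (- (b + 1) / (2 * a)) * a + (- (b + 1) / (2 * a)) ^+ 2 * 0 = -1.
    by rewrite oppr_ge0 ler10.
  by field; rewrite a0.
have := q c (- a).
have -> : c ^+ 2 * b + 2 * c * - a * a + (- a) ^+ 2 * c = c * (b * c - a ^+ 2) by ring.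
by rewrite pmulr_rge0 // subr_ge0.
Qed.

Lemma ip_CS (F : rcfType) d (x y : 'cV[F]_d) : (ip x y) ^+ 2 <= ip x x * ip y y.
Proof.
have := @psd_CS F d 1%:M x y (trmx1 _ _); rewrite !mul1mx; apply => z.
by rewrite mul1mx ip_ge0.
Qed.

(** Cauchy-Schwarz between [M x] and [x] bounds the square of [|M x|^2] by a multiple of
    [x^T M x]. *)
Lemma psd_ker (F : rcfType) d (M : 'M[F]_d) x : M^T = M -> psd M ->
  ip x (M *m x) = 0 -> M *m x = 0.
Proof.
move=> sM pM x0; apply/eqP; rewrite -ip_eq0.
rewrite -sqrf_eq0 eq_le sqr_ge0 andbT; apply: le_trans (psd_CS _ _ sM pM) _.
by rewrite x0 mulr0.
Qed.

(** Over the algebraically closed extension an eigenvalue exists; symmetry makes it real, and then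
    the real and imaginary parts of its eigenvector both satisfy the eigenvalue equation, one of
    them being nonzero. *)
Lemma sym_eigen_real (F : rcfType) n (G : 'M[F]_n.+1) : G^T = G ->
  exists l (x : 'cV[F]_n.+1), x != 0 /\ G *m x = l *: x.
Proof.
move=> sG; set c := real_complex F.
have [a] := @eigenvalue_closed (complex F) n.+1 (map_mx c G) isT.
case/eigenvalueP=> v vG v0.
pose x : 'cV[F]_n.+1 := \col_j complex.Re (v 0 j).
pose y : 'cV[F]_n.+1 := \col_j complex.Im (v 0 j).
set l := complex.Re a; set b := complex.Im a.
have E j : (\sum_k v 0 k * c (G k j)) = a * v 0 j.
  have := congr1 (fun M : 'rV_n.+1 => M 0 j) vG; rewrite !mxE => <-.
  by apply: eq_bigr => k _; rewrite mxE.
have Gx : G *m x = l *: x - b *: y.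
  apply/colP => j; rewrite !mxE.
  have := congr1 (@complex.Re F) (E j); rewrite raddf_sum.
  rewrite (_ : complex.Re (a * v 0 j) = l * complex.Re (v 0 j) - b * complex.Im (v 0 j)); last first.
    by rewrite /l /b; case: (v 0 j) (a) => ? ? [? ?].
  move=> <-; apply: eq_bigr => k _; rewrite !mxE -[in LHS]sG mxE.
  by case: (v 0 k) => ? ? /=; rewrite mulr0 subr0 mulrC.
have Gy : G *m y = l *: y + b *: x.
  apply/colP => j; rewrite !mxE.
  have := congr1 (@complex.Im F) (E j); rewrite raddf_sum.
  rewrite (_ : complex.Im (a * v 0 j) = l * complex.Im (v 0 j) + b * complex.Re (v 0 j)); last first.
    by rewrite /l /b; case: (v 0 j) (a) => ? ? [? ?].
  move=> <-.
  apply: eq_bigr => k _; rewrite !mxE -[in LHS]sG mxE.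
  by case: (v 0 k) => ? ? /=; rewrite mulr0 add0r mulrC.
have xy0 : ip x x + ip y y != 0.
  apply: contra v0; rewrite paddr_eq0 ?ip_ge0 // !ip_eq0 => /andP[/eqP hx /eqP hy].
  apply/eqP/rowP => j; rewrite mxE; apply/eqP; rewrite eq_complex /=.
  have := congr1 (fun M : 'cV_n.+1 => M j 0) hx; rewrite !mxE => ->.
  by have := congr1 (fun M : 'cV_n.+1 => M j 0) hy; rewrite !mxE => ->; rewrite eqxx.
(* Expanding [x^T G y] in two ways leaves [b (|x|^2 + |y|^2) = 0]. *)
have b0 : b = 0.
  have : ip x (G *m y) = ip (G *m x) y by rewrite ip_mulr sG.
  rewrite Gx Gy ipDr ipBl !ipZl !ipZr => /eqP; rewrite -subr_eq0.
  have -> : l * ip x y + b * ip x x - (l * ip x y - b * ip y y) = b * (ip x x + ip y y) by ring.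
  by rewrite mulf_eq0 (negPf xy0) orbF => /eqP.
have [x0|x0] := eqVneq x 0; last by exists l, x; split=> //; rewrite Gx b0 scale0r subr0.
exists l, y; split; last by rewrite Gy b0 scale0r addr0.
by apply: contra xy0 => /eqP ->; rewrite x0 !ip0l addr0.
Qed.

(** The reflection exchanging [e_k] and [v], with normal [w = e_k - v]; for [e_k = v] the normal
    vanishes and the identity serves. *)
Lemma householder (F : rcfType) n (v : 'cV[F]_n) k : ip v v = 1 ->
  exists Q : 'M[F]_n, [/\ Q^T = Q, Q *m Q = 1%:M & Q *m delta_mx k 0 = v].
Proof.
move=> v1; set e : 'cV[F]_n := delta_mx k 0.
have e1 : ip e e = 1 by rewrite ip_delta mxE !eqxx.
have [ev|ev] := eqVneq e v.
  by exists 1%:M; rewrite trmx1 !mul1mx.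
set w := e - v; have w0 : ip w w != 0 by rewrite ip_eq0 subr_eq0.
have wE : ip w w = 2 * ip w e.
  rewrite /w !(ipBl, ipBr) v1 e1 (ipC v e); ring.
exists (1%:M - (2 / ip w w) *: (w *m w^T)); split.
- by rewrite linearB linearZ /= trmx1 trmx_outer.
- have WW : w *m w^T *m (w *m w^T) = ip w w *: (w *m w^T).
    by rewrite mulmxA outer_mul -scalemxAl.
  set X := w *m w^T in WW *; rewrite mulmxBl mul1mx mulmxBr mulmx1.
  rewrite -scalemxAl -scalemxAr WW !scalerA -addrA -[RHS]addr0; congr (_ + _).
  rewrite opprB addrCA -scaleNr -!scalerDl -[RHS](scale0r X); congr (_ *: _).
  by field.
- rewrite mulmxBl mul1mx -scalemxAl outer_mul scalerA wE.
  have -> : 2 / (2 * ip w e) * ip w e = 1.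
    by field; move: w0; rewrite wE mulf_eq0 pnatr_eq0.
  by rewrite scale1r /w opprB addrC subrK.
Qed.

(** * The spectral theorem *)

(** Deflation: a reflection carries the first basis vector to a unit eigenvector, which splits off a
    1 by 1 block, and induction treats the remaining block. The rows of [V] are the eigenvectors. *)
Lemma sym_spectral (F : rcfType) n (G : 'M[F]_n) : G^T = G ->
  exists (V : 'M[F]_n) (D : 'rV[F]_n), V^T *m V = 1%:M /\ G = V^T *m diag_mx D *m V.
Proof.
elim: n G => [|n IH] G sG.
  by exists 1%:M, 0; split; apply/matrixP => -[].
have [l [x [x0 Gx]]] := sym_eigen_real sG.
have xx0 : 0 < ip x x by rewrite ip_gt0.
pose v := (Num.sqrt (ip x x))^-1 *: x.
have s0 : Num.sqrt (ip x x) != 0 by rewrite sqrtr_eq0 -ltNge.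
have v1 : ip v v = 1.
  rewrite ipZl ipZr mulrA -invfM -expr2 sqr_sqrtr ?ltW // mulVf //.
  by rewrite gt_eqF.
have Gv : G *m v = l *: v by rewrite -scalemxAr Gx !scalerA mulrC.
have [Q [QT QQ Qe]] := householder (0 : 'I_(1 + n)) v1.
pose G1 : 'M[F]_(1 + n) := Q *m G *m Q.
have sG1 : G1^T = G1 by rewrite /G1 !trmx_mul QT sG mulmxA.
have G1e : G1 *m delta_mx 0 0 = l *: (delta_mx 0 0 : 'cV_(1 + n)).
  by rewrite /G1 -!mulmxA Qe Gv -scalemxAr -Qe mulmxA QQ mul1mx.
(* An opaque copy keeps the block extractions from unfolding the product. *)
have [G2 G2E] : {G2 : 'M[F]_(1 + n) | G2 = G1} by exists G1.
rewrite -G2E in sG1 G1e.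
have dl : dlsubmx G2 = 0.
  apply/matrixP => i j; rewrite ord1 !mxE.
  have := congr1 (fun M : 'cV_(1 + n) => M (rshift 1 i) 0) G1e.
  by rewrite -colE !mxE /= mulr0 => <-; congr (G2 _ _); apply/val_inj.
have ul : ulsubmx G2 = l%:M.
  apply/matrixP => i j; rewrite !ord1 !mxE.
  have := congr1 (fun M : 'cV_(1 + n) => M 0 0) G1e.
  by rewrite -colE !mxE /= mulr1 mulr1n => <-; congr (G2 _ _); apply/val_inj.
have ur : ursubmx G2 = 0.
  by rewrite -[ursubmx G2]trmxK trmx_ursub sG1 dl trmx0.
have sdr : (drsubmx G2)^T = drsubmx G2 by rewrite trmx_drsub sG1.
have [V [D [VV GE]]] := IH _ sdr.
pose B : 'M[F]_(1 + n) := block_mx 1%:M 0 0 V.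
have BT : B^T = block_mx 1%:M 0 0 V^T by rewrite tr_block_mx !trmx0 trmx1.
have BB : B^T *m B = 1%:M.
  rewrite BT mulmx_block !(mulmx0, mul0mx, mulmx1, addr0, add0r) VV.
  by rewrite -scalar_mx_block.
pose E : 'rV[F]_(1 + n) := row_mx l%:M D.
have EE : diag_mx E = block_mx l%:M 0 0 (diag_mx D).
  rewrite diag_mx_row; congr block_mx.
  by apply/matrixP => i j; rewrite !ord1 !mxE.
have BEB : B^T *m diag_mx E *m B = G1.
  rewrite BT EE !mulmx_block !(mulmx0, mul0mx, mulmx1, mul1mx, addr0, add0r) -GE.
  by rewrite -G2E -[G2 in RHS]submxK ul dl ur.
exists (B *m Q), E; split.
  by rewrite trmx_mul QT mulmxA -[X in X *m _]mulmxA BB mulmx1 QQ.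
have -> : (B *m Q)^T *m diag_mx E *m (B *m Q) = Q *m (B^T *m diag_mx E *m B) *m Q.
  by rewrite trmx_mul QT !mulmxA.
by rewrite BEB /G1 -!mulmxA QQ mulmx1 mulmxA QQ mul1mx.
Qed.

Lemma spectral_mulmxV (F : rcfType) n (V : 'M[F]_n) : V^T *m V = 1%:M -> V *m V^T = 1%:M.
Proof. exact: mulmx1C. Qed.

Lemma mul_diag_col (F : rcfType) n (D : 'rV[F]_n) (y : 'cV[F]_n) k :
  (diag_mx D *m y) k 0 = D 0 k * y k 0.
Proof. by rewrite mul_diag_mx !mxE. Qed.

Lemma exp_diag (F : rcfType) n (D : 'rV[F]_n) N :
  diag_mx D ^+ N = diag_mx (\row_k D 0 k ^+ N).
Proof.
elim: N => [|N IH].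
  rewrite expr0 -[LHS]diag_const_mx; congr diag_mx; apply/rowP => k.
  by rewrite !mxE expr0.
rewrite exprS IH [LHS]mulmx_diag; congr diag_mx; apply/rowP => k.
by rewrite !mxE exprS.
Qed.

Lemma exp_conj (F : rcfType) n (V M : 'M[F]_n) N : V^T *m V = 1%:M ->
  (V^T *m M *m V) ^+ N = V^T *m (M ^+ N) *m V.
Proof.
move=> VV; have VV' := spectral_mulmxV VV.
elim: N => [|N IH]; first by rewrite !expr0 mulmx1 VV.
rewrite exprS IH -[LHS]/(_ *m _) exprS -!mulmxA; congr (_ *m (_ *m _)).
by rewrite mulmxA VV' mul1mx.
Qed.

Lemma spectral_quad (F : rcfType) n (V : 'M[F]_n) (D : 'rV[F]_n) x :
  ip x (V^T *m diag_mx D *m V *m x) = \sum_k D 0 k * (V *m x) k 0 ^+ 2.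
Proof.
rewrite -2!mulmxA ip_mulr trmxK /ip; apply: eq_bigr => k _.
by rewrite mul_diag_col mulrCA expr2.
Qed.

Lemma spectral_norm (F : rcfType) n (V : 'M[F]_n) x : V^T *m V = 1%:M ->
  \sum_k (V *m x) k 0 ^+ 2 = ip x x.
Proof.
move=> VV; transitivity (ip (V *m x) (V *m x)).
  by apply: eq_bigr => k _; rewrite expr2.
by rewrite ip_mull mulmxA VV mul1mx.
Qed.

Lemma spectral_trace (F : rcfType) n (V : 'M[F]_n) (D : 'rV[F]_n) : V^T *m V = 1%:M ->
  \tr (V^T *m diag_mx D *m V) = \sum_k D 0 k.
Proof. by move=> VV; rewrite mxtrace_mulC mulmxA spectral_mulmxV // mul1mx mxtrace_diag. Qed.

Lemma spectral_det (F : rcfType) n (V : 'M[F]_n) (D : 'rV[F]_n) : V^T *m V = 1%:M ->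
  \det (V^T *m diag_mx D *m V) = \prod_k D 0 k.
Proof.
move=> VV; rewrite !det_mulmx det_diag mulrC mulrA -det_mulmx.
by rewrite spectral_mulmxV // det1 mul1r.
Qed.

Lemma spectral_eigenvalue (F : rcfType) n (V : 'M[F]_n) (D : 'rV[F]_n) k : V^T *m V = 1%:M ->
  V^T *m diag_mx D *m V *m (V^T *m delta_mx k 0 : 'cV_n) = D 0 k *: (V^T *m delta_mx k 0).
Proof.
move=> VV; rewrite mulmxA -[X in X *m _]mulmxA spectral_mulmxV // mulmx1 -mulmxA.
rewrite scalemxAr; congr (_ *m _); apply/colP => i; rewrite mul_diag_col !mxE.
by case: eqVneq => [->|]; rewrite ?mulr0.
Qed.

Lemma ip_spectral_vec (F : rcfType) n (V : 'M[F]_n) k (x : 'cV[F]_n) :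
  ip x (V^T *m delta_mx k 0) = (V *m x) k 0.
Proof. by rewrite ip_mulr trmxK ip_delta. Qed.

Lemma spectral_vec_norm (F : rcfType) n (V : 'M[F]_n) k : V^T *m V = 1%:M ->
  ip (V^T *m delta_mx k 0) (V^T *m delta_mx k 0) = 1.
Proof. by move=> VV; rewrite ip_spectral_vec mulmxA spectral_mulmxV // mul1mx mxE !eqxx. Qed.

Lemma spectral_lb (F : rcfType) n (V : 'M[F]_n) (D : 'rV[F]_n) (a : F) k : V^T *m V = 1%:M ->
  (forall x : 'cV[F]_n, a * ip x x <= ip x (V^T *m diag_mx D *m V *m x)) -> a <= D 0 k.
Proof.
move=> VV /(_ (V^T *m delta_mx k 0)).
by rewrite spectral_eigenvalue // ipZr spectral_vec_norm // !mulr1.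
Qed.

Lemma spectral_ub (F : rcfType) n (V : 'M[F]_n) (D : 'rV[F]_n) (a : F) k : V^T *m V = 1%:M ->
  (forall x : 'cV[F]_n, ip x (V^T *m diag_mx D *m V *m x) <= a * ip x x) -> D 0 k <= a.
Proof.
move=> VV /(_ (V^T *m delta_mx k 0)).
by rewrite spectral_eigenvalue // ipZr spectral_vec_norm // !mulr1.
Qed.

(* Symmetrising the double sum turns the difference of the two sides into a sum
   of the products (D_a^i - D_b^i)(D_a^j - D_b^j), which are nonnegative. *)
Lemma moment_logconvex (F : rcfType) n (P : 'M[F]_n) u i j : P^T = P -> psd P ->
  ip u (P ^+ i *m u) * ip u (P ^+ j *m u) <= ip u u * ip u (P ^+ (i + j) *m u).
Proof.
move=> sP pP; have [V [D [VV PE]]] := sym_spectral sP.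
have D0 k : 0 <= D 0 k.
  by apply: (spectral_lb (V := V)) => // x; rewrite mul0r -PE.
pose w k := (V *m u) k 0 ^+ 2.
have E m : ip u (P ^+ m *m u) = \sum_k D 0 k ^+ m * w k.
  by rewrite PE exp_conj // exp_diag spectral_quad; apply: eq_bigr => k _; rewrite mxE.
have E0 : ip u u = \sum_k w k by rewrite spectral_norm.
rewrite !E E0 !big_distrlr /= -(ler_pMn2r (n := 2)) // !mulr2n.
rewrite [X in _ + X <= _]exchange_big [X in _ <= _ + X]exchange_big -!big_split.
apply: ler_sum => a _; rewrite -!big_split; apply: ler_sum => b _ /=.
rewrite -subr_ge0 !exprD.
have -> : w a * (D 0 b ^+ i * D 0 b ^+ j * w b) + w b * (D 0 a ^+ i * D 0 a ^+ j * w a) -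
  (D 0 a ^+ i * w a * (D 0 b ^+ j * w b) + D 0 b ^+ i * w b * (D 0 a ^+ j * w a)) =
  w a * w b * ((D 0 b ^+ i - D 0 a ^+ i) * (D 0 b ^+ j - D 0 a ^+ j)) by ring.
apply: mulr_ge0; first by rewrite mulr_ge0 ?sqr_ge0.
have mono m : D 0 a <= D 0 b -> D 0 a ^+ m <= D 0 b ^+ m.
  by move=> h; rewrite lerXn2r ?nnegrE.
have mono' m : D 0 b <= D 0 a -> D 0 b ^+ m <= D 0 a ^+ m.
  by move=> h; rewrite lerXn2r ?nnegrE.
have [ab|/ltW ba] := lerP (D 0 a) (D 0 b).
  by rewrite mulr_ge0 // subr_ge0 mono.
by rewrite mulr_le0 // subr_le0 mono'.
Qed.

(** In the eigenbasis this is [a D^m <= D^(m+1)], term by term with weights [(V u)_k^2]. *)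
Lemma moment_step (F : rcfType) n (P : 'M[F]_n) u (a : F) m : P^T = P -> 0 <= a ->
  (forall x : 'cV[F]_n, a * ip x x <= ip x (P *m x)) ->
  a * ip u (P ^+ m *m u) <= ip u (P ^+ m.+1 *m u).
Proof.
move=> sP a0 pP; have [V [D [VV PE]]] := sym_spectral sP.
have Da k : a <= D 0 k by apply: (spectral_lb (V := V)) => // x; rewrite -PE.
have E l : ip u (P ^+ l *m u) = \sum_k D 0 k ^+ l * (V *m u) k 0 ^+ 2.
  by rewrite PE exp_conj // exp_diag spectral_quad; apply: eq_bigr => k _; rewrite mxE.
rewrite !E mulr_sumr; apply: ler_sum => k _.
move: (sqr_ge0 ((V *m u) k 0)); move: (_ ^+ 2) => w w0; rewrite exprS !mulrA; apply: ler_wpM2r => //.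
by apply: ler_wpM2r => //; apply: exprn_ge0; apply: le_trans (Da k).
Qed.

Lemma expmx_sym (F : rcfType) n (P : 'M[F]_n) m : P^T = P -> (P ^+ m)^T = P ^+ m.
Proof.
move=> sP; elim: m => [|m IH]; first by rewrite expr0 trmx1.
by rewrite {1}exprS exprSr -[P * _]/(_ *m _) trmx_mul IH sP.
Qed.

(** An even power has nonnegative eigenvalues, and on a unit vector its form is an average of them,
    hence at most their sum. *)
Lemma trace_even_ge (F : rcfType) n (P : 'M[F]_n) m x : P^T = P -> ip x x = 1 ->
  ip x (P ^+ m.*2 *m x) <= \tr (P ^+ m.*2).
Proof.
move=> sP x1; have [V [D [VV PE]]] := sym_spectral sP.
rewrite PE exp_conj // exp_diag spectral_quad spectral_trace //.
apply: ler_sum => k _; rewrite [X in X * _]mxE [leRHS]mxE -[leRHS]mulr1; apply: ler_wpM2l.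
  by rewrite -mul2n exprM exprn_ge0 ?sqr_ge0.
rewrite -x1 -(spectral_norm x VV) [leRHS](bigD1 k) //= lerDl.
by apply: sumr_ge0 => i _; rewrite sqr_ge0.
Qed.

Lemma trace_even_ge0 (F : rcfType) n (P : 'M[F]_n) m : P^T = P -> 0 <= \tr (P ^+ m.*2).
Proof.
move=> sP; have [V [D [VV PE]]] := sym_spectral sP.
rewrite PE exp_conj // exp_diag spectral_trace //.
apply: sumr_ge0 => k _; rewrite !mxE -mul2n exprM exprn_ge0 ?sqr_ge0 //.
Qed.

(** Each squaring of [B = P^(2^k)] costs one Cauchy-Schwarz step,
    [(x^T B x)^2 <= |B x|^2 = x^T B^2 x]; this is why the exponent of the potential is a power of
    two. *)
Lemma quad_pow2_le (F : rcfType) n (P : 'M[F]_n) x k (a : F) : P^T = P -> ip x x = 1 ->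
  0 <= a -> a <= ip x (P *m x) -> a ^+ (2 ^ k) <= ip x (P ^+ (2 ^ k) *m x).
Proof.
move=> sP x1 a0 ax; elim: k => [|k IH]; first by rewrite expn0 !expr1.
rewrite expnSr !exprM; set B := P ^+ (2 ^ k) in IH *.
have -> : ip x (B ^+ 2 *m x) = ip (B *m x) (B *m x).
  by rewrite expr2 -[B * B]/(B *m B) -mulmxA ip_mulr expmx_sym.
apply: le_trans (_ : ip x (B *m x) ^+ 2 <= _).
  by rewrite lerXn2r // nnegrE ?exprn_ge0 // (le_trans _ IH) ?exprn_ge0.
by apply: le_trans (ip_CS _ _) _; rewrite x1 mul1r.
Qed.

(** * Isotropic position, determinants and pseudo-inverses *)

(* For [G = A^T A] the columns of [A T] form an orthonormal family (padded with
   zeros) spanning the column space of [A]; the vectors [T^T a_i] are the rows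
   of A in isotropic position. *)
Lemma isotropic_position (F : rcfType) d (G : 'M[F]_d) : G^T = G -> psd G ->
  exists T : 'M[F]_d,
    [/\ forall y, ip (T *m y) (G *m (T *m y)) <= ip y y,
        forall x, exists y, ip y y = ip x (G *m x) /\ G *m (x - T *m y) = 0 &
        forall a, (forall z, G *m z = 0 -> ip a z = 0) ->
          G *m (T *m (T^T *m a)) = a].
Proof.
move=> sG pG; have [V [D [VV GE]]] := sym_spectral sG.
have VV' := spectral_mulmxV VV.
have D0 k : 0 <= D 0 k.
  by apply: (spectral_lb (V := V)) => // x; rewrite mul0r -GE.
pose s k := Num.sqrt (D 0 k).
have sE k : s k ^+ 2 = D 0 k by rewrite sqr_sqrtr.
(* Since [0^-1 = 0], this inverts the square root of [G] on its range and vanishes on the kernel. *)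
pose S := diag_mx (\row_k (s k)^-1).
have GT : G *m (V^T *m S) = V^T *m diag_mx (\row_k s k).
  rewrite GE -!mulmxA [V *m _]mulmxA VV' mul1mx mulmx_diag; congr (_ *m diag_mx _).
  apply/rowP => k; rewrite !mxE -sE.
  by have [->|n0] := eqVneq (s k) 0; [rewrite expr0n mul0r | rewrite expr2 mulfK].
exists (V^T *m S); split.
- move=> y; rewrite mulmxA GT -!mulmxA ip_mulr trmxK mulmxA VV' mul1mx.
  apply: ler_sum => k _; rewrite !mul_diag_col !mxE.
  have [->|n0] := eqVneq (s k) 0; first by rewrite mul0r mulr0 -expr2 sqr_ge0.
  by rewrite mulrACA mulVf // mul1r.
- move=> x; exists (diag_mx (\row_k s k) *m (V *m x)); split.
    rewrite GE -!mulmxA ip_mulr trmxK; apply: eq_bigr => k _.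
    rewrite !mul_diag_col !mxE -sE; ring.
  rewrite mulmxBr [G *m _ in X in _ - X]mulmxA GT GE -!mulmxA -mulmxBr.
  rewrite (_ : _ - _ = 0) ?mulmx0 //; apply/colP => k.
  rewrite [LHS]mxE [X in _ + X]mxE [RHS]mxE !mul_diag_col !mxE -sE.
  by rewrite expr2 mulrA subrr.
- move=> a az; rewrite trmx_mul trmxK tr_diag_mx !mulmxA -[G *m _ *m _]mulmxA GT.
  rewrite -[RHS]mul1mx -VV -!mulmxA; congr (_ *m _); apply/colP => k.
  rewrite !mul_diag_col !mxE.
  have [s0|n0] := eqVneq (s k) 0; last by rewrite mulVKf.
  rewrite s0 mul0r; transitivity ((V *m a) k 0); last by rewrite mxE.
  rewrite -ip_spectral_vec az // GE spectral_eigenvalue //.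
  by rewrite -sE s0 expr0n scale0r.
Qed.

(** One bordered matrix [B] is factored into block triangular matrices in two ways; comparing
    determinants gives the identity. *)
Lemma det_rank1 (F : fieldType) n (u v : 'cV[F]_n) :
  \det (1%:M + u *m v^T) = 1 + (v^T *m u) 0 0.
Proof.
pose B : 'M[F]_(1 + n) := block_mx 1%:M (- v^T) u 1%:M.
have B1 : B = block_mx 1%:M 0 u 1%:M *m block_mx 1%:M (- v^T) 0 (1%:M + u *m v^T).
  rewrite mulmx_block !(mulmx0, mul0mx, mulmx1, mul1mx, addr0, add0r).
  by rewrite mulmxN [X in block_mx _ _ _ X]addrCA addNr addr0.
have B2 : B = block_mx (1%:M + v^T *m u) (- v^T) 0 1%:M *m block_mx 1%:M 0 u 1%:M.
  rewrite mulmx_block !(mulmx0, mul0mx, mulmx1, mul1mx, addr0, add0r).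
  by rewrite mulNmx addrK.
have := congr1 determinant B1; rewrite {1}B2 !det_mulmx !(det_lblock, det_ublock).
by rewrite !det1 !(mulr1, mul1r) det_mx11 !mxE => <-; rewrite mulr1n.
Qed.

Lemma spectral_shift (F : rcfType) n (V : 'M[F]_n) (D : 'rV[F]_n) l : V^T *m V = 1%:M ->
  l%:M + V^T *m diag_mx D *m V = V^T *m diag_mx (\row_k (l + D 0 k)) *m V.
Proof.
move=> VV; have -> : diag_mx (\row_k (l + D 0 k)) = l%:M + diag_mx D.
  by apply/matrixP => i j; rewrite !mxE -mulrnDl.
by rewrite mulmxDr mulmxDl mul_mx_scalar -scalemxAl VV scalemx1.
Qed.

Lemma det_posdef_gt0 (F : rcfType) n (M : 'M[F]_n) : M^T = M ->
  (forall x : 'cV_n, x != 0 -> 0 < ip x (M *m x)) -> 0 < \det M.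
Proof.
move=> sM pM; have [V [D [VV ME]]] := sym_spectral sM.
rewrite ME spectral_det //; apply: prodr_gt0 => k _.
have e1 := spectral_vec_norm k VV.
have := pM (V^T *m delta_mx k 0).
rewrite {1}ME spectral_eigenvalue // ipZr e1 mulr1; apply.
by rewrite -ip_eq0 e1 oner_eq0.
Qed.

(** For [y = M^-1 b] the update multiplies the determinant by [1 + b^T y], and Cauchy-Schwarz for
    [M] gives [(b^T x)^2 <= (b^T y) (x^T M x)]. The free test vector [x] spares later computations
    any inverse of [M]. *)
Lemma det_rank1_update_ge (F : rcfType) n (M : 'M[F]_n) (b x : 'cV_n) : M^T = M ->
  (forall x : 'cV_n, x != 0 -> 0 < ip x (M *m x)) ->
  \det M * (ip x (M *m x) + ip b x ^+ 2) <= \det (M + b *m b^T) * ip x (M *m x).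
Proof.
move=> sM pM; have dM := det_posdef_gt0 sM pM.
have uM : M \in unitmx by rewrite unitmxE unitfE gt_eqF.
pose y := invmx M *m b.
have My : M *m y = b by rewrite mulmxA mulmxV // mul1mx.
have -> : M + b *m b^T = M *m (1%:M + y *m b^T) by rewrite mulmxDr mulmx1 mulmxA My.
rewrite det_mulmx det_rank1 -ipE -mulrA; apply: ler_wpM2l; first exact: ltW.
rewrite mulrDl mul1r lerD2l -My (ipC (M *m y) y) (ipC (M *m y) x) mulrC.
apply: psd_CS => // z; have [->|z0] := eqVneq z 0; first by rewrite ip0l.
exact/ltW/pM.
Qed.

(** Restricting to the rows and columns of the nonzero entries leaves an invertible diagonal
    matrix. *)
Lemma rank_diag_ge (F : fieldType) n (D : 'rV[F]_n) :
  (#|[pred k | D ord0 k != 0%R]| <= \rank (diag_mx D))%N.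
Proof.
set I := [pred k | _]; pose f (i : 'I_#|I|) := enum_val i.
pose E : 'M[F]_(#|I|, n) := rowsub f 1%:M.
have EE : E *m diag_mx D *m E^T = diag_mx (\row_i D 0 (f i)).
  apply/matrixP => i j; rewrite !mxE (bigD1 (f i)) //= big1 => [|k ki].
    rewrite mul_mx_diag !mxE eqxx mul1r addr0 (inj_eq enum_val_inj).
    by rewrite eq_sym mulr_natr.
  by rewrite mul_mx_diag !mxE eq_sym (negPf ki) !mul0r.
have uE : E *m diag_mx D *m E^T \in unitmx.
  rewrite EE unitmxE det_diag unitfE prodf_seq_neq0; apply/allP => i _.
  by rewrite mxE; apply/implyP => _; have := enum_valP i.
have := mxrank_unit uE => <-.
by apply: leq_trans (mxrankM_maxl _ _) (mxrankM_maxr _ _).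
Qed.

(** At most [q] eigenvalues are nonzero; each of these becomes at most [l + b] after the shift and
    all others become [l]. The factor [l ^+ q] avoids a truncated exponent [n - q]. *)
Lemma det_shift_le (F : rcfType) n (G : 'M[F]_n) (l b : F) q : G^T = G -> psd G ->
  (forall x : 'cV_n, ip x (G *m x) <= b * ip x x) -> (\rank G <= q)%N ->
  0 < l -> 0 <= b ->
  \det (l%:M + G) * l ^+ q <= l ^+ n * (l + b) ^+ q.
Proof.
move=> sG pG Gb rG l0 b0; have [V [D [VV GE]]] := sym_spectral sG.
have D0 k : 0 <= D 0 k.
  by apply: (spectral_lb (V := V)) => // x; rewrite mul0r -GE.
have Db k : D 0 k <= b by apply: (spectral_ub (V := V)) => // x; rewrite -GE.
have sq : (#|[pred k | D ord0 k != 0%R]| <= q)%N.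
  apply: leq_trans rG; apply: leq_trans (rank_diag_ge D) _.
  have -> : diag_mx D = V *m G *m V^T.
    rewrite GE !mulmxA spectral_mulmxV // mul1mx -mulmxA spectral_mulmxV //.
    by rewrite mulmx1.
  by apply: leq_trans (mxrankM_maxl _ _) (mxrankM_maxr _ _).
rewrite GE spectral_shift // spectral_det //.
rewrite (bigID [pred k | D 0 k != 0]) /=.
move: sq; set s := #|_| => sq.
have lb : l <= l + b by rewrite lerDl.
have h1 : \prod_(k | D 0 k != 0) (\row_k (l + D 0 k)) 0 k <= (l + b) ^+ s.
  rewrite -prodr_const; apply: ler_prod => k _; rewrite mxE lerD2l Db andbT.
  by rewrite addr_ge0 // ltW.
have h2 : \prod_(k | ~~ (D 0 k != 0)) (\row_k (l + D 0 k)) 0 k = l ^+ (n - s).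
  rewrite (eq_bigr (fun=> l)) => [|k]; last by rewrite negbK mxE => /eqP ->; rewrite addr0.
  rewrite prodr_const; congr (_ ^+ _).
  have := cardC [pred k | D 0 k != 0]; rewrite card_ord -/s => /(congr1 (subn^~ s)).
  by rewrite addKn => <-; apply: eq_card => k; rewrite !inE.
have sn : (s <= n)%N by rewrite -[n in (_ <= n)%N]card_ord max_card.
rewrite h2 -mulrA -exprD.
have -> : (n - s + q = n + (q - s))%N by rewrite addnBA // addnBAC.
apply: le_trans (_ : (l + b) ^+ s * l ^+ (n + (q - s)) <= _).
  by apply: ler_wpM2r => //; rewrite exprn_ge0 // ltW.
rewrite exprD mulrCA; apply: ler_wpM2l; first by rewrite exprn_ge0 // ltW.
rewrite -[in leRHS](subnKC sq) exprD; apply: ler_wpM2l.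
  by rewrite exprn_ge0 // addr_ge0 // ltW.
by rewrite lerXn2r ?nnegrE ?(ltW l0) // addr_ge0 // ltW.
Qed.

Lemma sym_pinv_exists (F : rcfType) n (M : 'M[F]_n) : M^T = M ->
  exists X : 'M[F]_n, [/\ M *m X *m M = M, X *m M *m X = X,
    (M *m X)^T = M *m X & (X *m M)^T = X *m M].
Proof.
move=> sM; have [V [D [VV ME]]] := sym_spectral sM.
have VV' := spectral_mulmxV VV.
pose E := \row_k (D 0 k)^-1; exists (V^T *m diag_mx E *m V).
have mul3 (a b : 'rV[F]_n) : V^T *m diag_mx a *m V *m (V^T *m diag_mx b *m V) =
    V^T *m diag_mx (\row_k (a 0 k * b 0 k)) *m V.
  rewrite -mulmx_diag !mulmxA; congr (_ *m _ *m _).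
  by rewrite -[LHS]mulmxA VV' mulmx1.
have tr3 (a : 'rV[F]_n) : (V^T *m diag_mx a *m V)^T = V^T *m diag_mx a *m V.
  by rewrite !trmx_mul trmxK tr_diag_mx mulmxA.
rewrite ME !mul3 !tr3; split=> //; congr (_ *m diag_mx _ *m _); apply/rowP => k;
  rewrite !mxE; have [->|n0] := eqVneq (D 0 k) 0; rewrite ?mul0r ?invr0 ?mul0r //.
  by rewrite mulfV // mul1r.
by rewrite mulVf // mul1r.
Qed.

(** The identities [X = X M X = (X M)^T X = M X^T X] exhibit the preimage. *)
Lemma pinv_range (F : rcfType) n (M X : 'M[F]_n) : M^T = M ->
  M *m X *m M = M -> X *m M *m X = X -> (M *m X)^T = M *m X ->
  (X *m M)^T = X *m M ->
  forall a : 'cV_n, exists w, X *m a = M *m w.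
Proof.
move=> sM _ h2 _ h4 a; exists (X^T *m (X *m a)).
by rewrite mulmxA -{1}h2 -h4 trmx_mul sM !mulmxA.
Qed.

(** * Rank-one updates of the trace of a power *)

Lemma derivable_pt_lim_sum (I : finType) (f : I -> R -> R) (f' : I -> R) t :
  (forall i, derivable_pt_lim (f i) t (f' i)) ->
  derivable_pt_lim (fun t => \sum_i f i t) t (\sum_i f' i).
Proof.
move=> df; have: forall s : seq I, derivable_pt_lim (fun t => \sum_(i <- s) f i t) t (\sum_(i <- s) f' i).
  elim=> [|i s IH].
    rewrite big_nil; apply: (derivable_pt_lim_ext (fun=> 0)) => [z|].
      by rewrite big_nil.
    exact: derivable_pt_lim_const.
  rewrite big_cons; apply: derivable_pt_lim_ext (derivable_pt_lim_plus _ _ _ _ _ (df i) IH) => z.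
  by rewrite big_cons.
exact.
Qed.

Lemma decreasing_01 (f f' : R -> R) (t : R) :
  (forall c, derivable_pt_lim f c (f' c)) ->
  (forall c, 0 <= c <= 1 -> f' c <= 0) -> 0 <= t <= 1 -> f t <= f 0.
Proof.
move=> df f'0 /andP[t0 t1]; have [->//|tn0] := eqVneq t 0.
have tp : Rlt 0 t by apply/RltP; rewrite lt_def tn0.
have [c [E [/RltP c0 /RltP ct]]] := MVT_cor2 f f' 0 t tp (fun c _ => df c).
move: E; rewrite !RealsE subr0 => E; rewrite -subr_le0 E.
rewrite mulr_le0_ge0 // f'0 // (ltW c0) /=.
exact: le_trans (ltW ct) t1.
Qed.

Definition mx_derivative {m n} (F : R -> 'M[R]_(m, n)) t (F' : 'M[R]_(m, n)) :=
  forall i j, derivable_pt_lim (fun t => F t i j) t (F' i j).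

Lemma mx_derivative_mul m n p (F : R -> 'M[R]_(m, n)) (G : R -> 'M[R]_(n, p)) t F' G' :
  mx_derivative F t F' -> mx_derivative G t G' ->
  mx_derivative (fun t => F t *m G t) t (F' *m G t + F t *m G').
Proof.
move=> dF dG i j; rewrite !mxE -big_split /=.
apply: (derivable_pt_lim_ext (fun t => \sum_k F t i k * G t k j)) => [z|].
  by rewrite mxE.
by apply: derivable_pt_lim_sum => k; apply: derivable_pt_lim_mult.
Qed.

Lemma mx_derivative_ext m n (F G : R -> 'M[R]_(m, n)) t F' G' :
  (forall t, F t = G t) -> F' = G' -> mx_derivative F t F' -> mx_derivative G t G'.
Proof.
move=> FG -> dF i j; apply: derivable_pt_lim_ext (dF i j) => z.
by rewrite FG.
Qed.

Lemma mx_derivative_cst m n (A : 'M[R]_(m, n)) t : mx_derivative (fun=> A) t 0.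
Proof. by move=> i j; rewrite mxE; apply: derivable_pt_lim_const. Qed.

Lemma mx_derivative_line m n (A Q : 'M[R]_(m, n)) t :
  mx_derivative (fun t => A + t *: Q) t Q.
Proof.
move=> i j; apply: (derivable_pt_lim_ext (fun t => A i j + t * Q i j)) => [z|].
  by rewrite !mxE.
rewrite -[Q i j in X in derivable_pt_lim _ _ X]add0r.
apply: derivable_pt_lim_plus; first exact: derivable_pt_lim_const.
rewrite -[X in derivable_pt_lim _ _ X]addr0 -[X in X + _]mul1r -[X in _ + X](mulr0 t).
apply: derivable_pt_lim_mult; first exact: derivable_pt_lim_id.
exact: derivable_pt_lim_const.
Qed.

Lemma mx_derivative_exp d (A Q : 'M[R]_d) k t : let P t := A + t *: Q in
  mx_derivative (fun t => P t ^+ k) t (\sum_(j < k) P t ^+ j *m Q *m P t ^+ (k - j.+1)).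
Proof.
move=> P; elim: k => [|k IH].
  by rewrite big_ord0; apply: mx_derivative_cst.
apply: (mx_derivative_ext _ _ (mx_derivative_mul (mx_derivative_line A Q t) IH)) => [z|].
  by rewrite exprS.
rewrite big_ord_recl expr0 mul1mx subn1 /=; congr (_ + _).
rewrite mulmx_sumr; apply: eq_bigr => j _.
by rewrite /bump /= add1n exprS subSS !mulmxA.
Qed.

Lemma moment_ge0 (F : rcfType) n (P : 'M[F]_n) u m : P^T = P -> psd P ->
  0 <= ip u (P ^+ m *m u).
Proof.
move=> sP pP; elim: m => [|m IH]; first by rewrite expr0 mul1mx ip_ge0.
rewrite -[X in X <= _](mul0r (ip u (P ^+ m *m u))); apply: moment_step => // x.
by rewrite mul0r.
Qed.

(* Along the segment from P to [P + s u u^T] the trace has derivative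
   [s m g] with [g = u^T P^(m-1) u], and log-convexity of the moments of P
   gives [g' <= kappa s g], so [g] grows at most exponentially. *)
Lemma trace_rank1_update (d m : nat) (P : 'M[R]_d) (u : 'cV[R]_d) (a : R) :
  P^T = P -> 0 < a -> (forall x : 'cV_d, a * ip x x <= ip x (P *m x)) ->
  exists K : R, 0 <= K /\ forall s : R,
    (forall x : 'cV_d, a * ip x x <= ip x ((P + s *: (u *m u^T)) *m x)) ->
    \tr ((P + s *: (u *m u^T)) ^+ m.+1) <=
      \tr (P ^+ m.+1) + K * (exp (m.+1%:R * ip u u / a * s) - 1).
Proof.
move=> sP a0 Pa; have [->|u0] := eqVneq u 0.
  by exists 0; split=> // s _; rewrite mul0mx scaler0 addr0 mul0r addr0.
have h0 : 0 < ip u u by rewrite ip_gt0.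
set k := m.+1%:R * ip u u / a; have k0 : 0 < k by rewrite divr_gt0 // mulr_gt0 // ltr0Sn.
have pP : psd P by move=> x; apply: le_trans (Pa x); rewrite mulr_ge0 ?ip_ge0 // ltW.
pose g0 := ip u (P ^+ m *m u).
(* [K] does not depend on [s]: the two outcomes of a coin share it, so only the mean of their
   exponentials matters later. Its value makes the derivative of [K exp (k s t)] equal to
   [m.+1 g0 s exp (k s t)]. *)
exists (m.+1%:R * g0 / k); split.
  by rewrite divr_ge0 ?(ltW k0) // mulr_ge0 ?ler0n // moment_ge0.
move=> s Psa; set Q := u *m u^T in Psa *.
pose B t := P + t *: (s *: Q).
have sB t : (B t)^T = B t by rewrite linearD !linearZ /= sP trmx_outer.
have Ba t : 0 <= t <= 1 -> forall x : 'cV_d, a * ip x x <= ip x (B t *m x).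
  case/andP=> t0 t1 x; have := Pa x; have := Psa x.
  rewrite /B !mulmxDl !ipDr -!scalemxAl !ipZr => h1 h2; nra.
have pB t : 0 <= t <= 1 -> psd (B t).
  by move=> t01 x; apply: le_trans (Ba t t01 x); rewrite mulr_ge0 ?ip_ge0 // ltW.
pose g t := ip u (B t ^+ m *m u).
pose g' t := s * \sum_(j < m) ip u (B t ^+ j *m u) * ip u (B t ^+ (m - j.+1) *m u).
have dg t : derivable_pt_lim g t (g' t).
  have := mx_derivative_mul (mx_derivative_cst u^T t)
    (mx_derivative_mul (@mx_derivative_exp d P (s *: Q) m t) (mx_derivative_cst u t)).
  move=> /(_ 0 0); rewrite mul0mx add0r mulmx0 addr0.
  set D := (X in derivable_pt_lim _ _ X).
  have -> : D = g' t.
    rewrite /D -ipE mulmx_suml {1}/ip.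
    transitivity (\sum_(j < m) ip u (B t ^+ j *m (s *: Q) *m B t ^+ (m - j.+1) *m u)).
      rewrite /ip exchange_big; apply: eq_bigr => i _.
      by rewrite summxE mulr_sumr.
    rewrite /g' mulr_sumr; apply: eq_bigr => j _.
    rewrite -scalemxAr -!scalemxAl ipZr -!mulmxA ip_mulr expmx_sym // mulmxA ip_outer.
    by congr (_ * (_ * _)); rewrite ip_mull expmx_sym.
  by apply: derivable_pt_lim_ext => z; rewrite -ipE.
(* The factor [s] treats both signs of [s] at once. Each of the [m] products of moments is bounded
   by log-convexity, and [moment_step] then raises the remaining power by one at the price
   [1 / a]. *)
have g'k t : 0 <= t <= 1 -> s * (g' t - k * s * g t) <= 0.
  move=> t01; rewrite /g' -mulrA [k * _]mulrCA -mulrBr mulrA -expr2.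
  apply: mulr_ge0_le0; first exact: sqr_ge0.
  rewrite subr_le0 /k /g; case: m {k k0 g0 g g' dg} => [|m].
    by rewrite big_ord0 !mulr_ge0 ?invr_ge0 ?moment_ge0 ?ler0n ?ip_ge0 ?(ltW a0) //; apply: pB.
  apply: le_trans (_ : \sum_(j < m.+1) ip u u * ip u (B t ^+ m *m u) <= _).
    apply: ler_sum => j _.
    have E : m = (j + (m.+1 - j.+1))%N by rewrite subSS subnKC // -ltnS.
    by rewrite [X in _ <= _ * ip u (B t ^+ X *m u)]E; apply: moment_logconvex => //; apply: pB.
  rewrite sumr_const card_ord -[X in X <= _]mulr_natl.
  have h1 := moment_step u m (sB t) (ltW a0) (Ba t t01).
  have h2 : ip u (B t ^+ m *m u) <= ip u (B t ^+ m.+1 *m u) / a by rewrite ler_pdivlMr // mulrC.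
  have h3 : 0 <= ip u (B t ^+ m.+1 *m u) / a by rewrite divr_ge0 ?(ltW a0) // moment_ge0 //; apply: pB.
  apply: le_trans (_ : m.+2%:R * (ip u u * (ip u (B t ^+ m.+1 *m u) / a)) <= _).
    apply: ler_pM; rewrite ?ler0n ?ler_nat ?ler_pM2l //.
    by rewrite mulr_ge0 ?ip_ge0 // moment_ge0 //; apply: pB.
  by rewrite le_eqVlt; apply/orP; left; apply/eqP; field; rewrite gt_eqF.
have dexp (c t : R) : derivable_pt_lim (fun t => exp (c * t)) t (c * exp (c * t)).
  have lin : derivable_pt_lim (fun t => c * t) t c.
    have := derivable_pt_lim_scal id c t 1 (derivable_pt_lim_id t).
    by rewrite RmultE mulr1.
  by rewrite mulrC; exact: derivable_pt_lim_comp lin (derivable_pt_lim_exp _).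
(* A Gronwall argument: [s g(t) exp (- k s t)] is nonincreasing on [0, 1]. *)
have gexp t : 0 <= t <= 1 -> s * (g t - g0 * exp (k * s * t)) <= 0.
  move=> t01.
  pose f t := s * (g t * exp (- (k * s) * t)).
  pose f' t := s * (g' t * exp (- (k * s) * t) + g t * (- (k * s) * exp (- (k * s) * t))).
  have df c : derivable_pt_lim f c (f' c).
    exact: (derivable_pt_lim_scal _ _ _ _ (derivable_pt_lim_mult _ _ _ _ _ (dg c) (dexp _ _))).
  have := @decreasing_01 f f' t df _ t01; rewrite /f.
  have -> : g 0 = g0 by rewrite /g /B scale0r addr0.
  rewrite mulr0 exp_0 mulr1 => /(_ _)/wrap[].
    move=> c c01; rewrite /f'.
    have -> : s * (g' c * exp (- (k * s) * c) + g c * (- (k * s) * exp (- (k * s) * c))) =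
      s * (g' c - k * s * g c) * exp (- (k * s) * c) by ring.
    by rewrite mulr_le0_ge0 ?g'k //; apply/ltW/RltP/exp_pos.
  move=> h; have e0 : 0 < exp (k * s * t) by apply/RltP/exp_pos.
  rewrite mulrBr subr_le0 mulrA -ler_pdivrMr //.
  have -> : s * g t / exp (k * s * t) = s * (g t * exp (- (k * s) * t)) by rewrite mulNr -RoppE exp_Ropp RinvE mulrA.
  exact: h.
(* Integration of the bound on [g]: this difference has a derivative of nonpositive sign, and its
   values at 1 and 0 are compared. *)
pose f t := \tr (B t ^+ m.+1) - m.+1%:R * g0 / k * exp (k * s * t).
pose f' t := m.+1%:R * (s * (g t - g0 * exp (k * s * t))).
have df t : derivable_pt_lim f t (f' t).
  have d1 : derivable_pt_lim (fun t => \tr (B t ^+ m.+1)) t (m.+1%:R * s * g t).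
    have := derivable_pt_lim_sum (fun i : 'I_d => @mx_derivative_exp d P (s *: Q) m.+1 t i i).
    set D := (X in derivable_pt_lim _ _ X); suff -> : D = m.+1%:R * s * g t by [].
    rewrite /D -[LHS]/(\tr _) raddf_sum /= -mulrA mulr_natl -[m.+1 in RHS]card_ord -sumr_const.
    apply: eq_bigr => j _; rewrite mxtrace_mulC mulmxA -/(B t).
    have -> : B t ^+ (m.+1 - j.+1) *m B t ^+ j = B t ^+ m.
      by rewrite -[LHS]/(_ * _) -exprD subSS subnK // -ltnS.
    rewrite -scalemxAr linearZ /= /g; congr (_ * _).
    by rewrite mulmxA mxtrace_mulC mulmxA ipE trace_mx11 -mulmxA.
  have := derivable_pt_lim_minus _ _ _ _ _ d1 (derivable_pt_lim_scal _ (m.+1%:R * g0 / k) _ _ (dexp (k * s) t)).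
  rewrite !RealsE; set D := (X in derivable_pt_lim _ _ X).
  suff -> : D = f' t by [].
  by rewrite /D /f'; field; rewrite gt_eqF.
have h01 : ((0 : R) <= (1 : R)) && ((1 : R) <= (1 : R)) by rewrite ler01 lexx.
have := @decreasing_01 f f' 1 df _ h01; rewrite /f.
have -> : B 0 = P by rewrite /B scale0r addr0.
have -> : B 1 = P + s *: Q by rewrite /B scale1r.
rewrite mulr0 exp_0 !mulr1 => /(_ _)/wrap[].
  by move=> c c01; rewrite /f' mulr_ge0_le0 ?ler0n // gexp.
move=> h; rewrite -/k; lra.
Qed.

(** * One sampling step *)

Lemma exp_gt0 (x : R) : 0 < exp x.
Proof. exact/RltP/exp_pos. Qed.

Lemma ler_exp (x y : R) : x <= y -> exp x <= exp y.
Proof.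
move=> xy; apply/RleP; have [->|ne] := eqVneq x y; first exact: Rle_refl.
by apply/Rlt_le/exp_increasing/RltP; rewrite lt_neqAle ne.
Qed.

Lemma exp_ge1Dx (x : R) : 1 + x <= exp x.
Proof.
have [->|x0] := eqVneq x 0; first by rewrite expR0 addr0.
by apply/RleP/Rlt_le/exp_ineq1/eqP.
Qed.

Lemma exp_le_inv (x : R) : x < 1 -> exp x <= (1 - x)^-1.
Proof.
move=> x1; have e0 := exp_gt0 (- x); have := exp_ge1Dx (- x).
have -> : exp x = (exp (- x))^-1 by rewrite -RinvE -exp_Ropp RoppE opprK.
by move=> h; rewrite lef_pV2 // posrE // subr_gt0.
Qed.

(** Differentiating in a scaling parameter [t], with [y = x t], reduces the claim to
    [exp y <= 1 + 33/25 y] for [y] in [0, 1/3] and to the opposite inequality for [y <= 0]. *)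
Lemma exp_le_quad (x : R) : `|x| <= 1 / 3 -> exp x <= 1 + x + 33 / 50 * x ^+ 2.
Proof.
move=> x13.
pose f t := exp (x * t) - (x * t + 33 / 50 * ((x * t) * (x * t))).
pose f' t := x * exp (x * t) - (x + 33 / 50 * (x * (x * t) + (x * t) * x)).
have dl t : derivable_pt_lim (fun t => x * t) t x.
  have := derivable_pt_lim_scal id x t 1 (derivable_pt_lim_id t).
  by rewrite RmultE mulr1.
have df t : derivable_pt_lim f t (f' t).
  apply: derivable_pt_lim_minus.
    by rewrite mulrC; exact: derivable_pt_lim_comp (dl t) (derivable_pt_lim_exp _).
  apply: derivable_pt_lim_plus => //; apply: derivable_pt_lim_scal.
  exact: derivable_pt_lim_mult.
have h01 : ((0 : R) <= (1 : R)) && ((1 : R) <= (1 : R)) by rewrite ler01 lexx.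
have := @decreasing_01 f f' 1 df _ h01; rewrite /f !mulr1 !mulr0 expR0 => /(_ _)/wrap[].
  move=> t /andP[t0 t1]; rewrite /f'.
  have -> : x * exp (x * t) - (x + 33 / 50 * (x * (x * t) + x * t * x)) =
    x * (exp (x * t) - 1 - 33 / 25 * (x * t)) by field.
  have [x0|x0] := lerP 0 x; last first.
    apply: mulr_le0_ge0; first exact: ltW.
    have := exp_ge1Dx (x * t); have : x * t <= 0 by nra.
    lra.
  rewrite ger0_norm // in x13.
  apply: mulr_ge0_le0 => //.
  set y := x * t; have y0 : 0 <= y by rewrite mulr_ge0.
  have y13 : y <= 1 / 3 by rewrite /y; nra.
  (* Squaring [exp (y / 2) <= 1 / (1 - y / 2)] is sharper than the same bound applied to [y], which
     would not suffice near 1/3. *)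
  have -> : y = y / 2 + y / 2 by field.
  rewrite -expRD; have := exp_le_inv (_ : y / 2 < 1) => /(_ _)/wrap[]; first lra.
  set w := exp _; have w0 : 0 < w by apply: exp_gt0.
  have p0 : 0 < 1 - y / 2 by lra.
  rewrite -[(1 - y / 2)^-1]div1r ler_pdivlMr // => h.
  set v := 1 - y / 2 in p0 h.
  have yE : y = 2 * (1 - v) by rewrite /v; field.
  have v1 : 5 / 6 <= v by rewrite /v; lra.
  have v2 : v <= 1 by rewrite /v; lra.
  have wv : w * w * (v * v) <= 1 by have := mulr_ge0 (ltW w0) (ltW p0); nra.
  have vv : 25 / 36 <= v * v by nra.
  suff : w * w <= 1 + 33 / 25 * y by lra.
  suff : 1 <= (1 + 33 / 25 * y) * (v * v) by nra.
  rewrite yE -subr_ge0.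
  (* The constant 33/50 is the one for which this expression vanishes at [v = 5/6], that is at
     [y = 1/3]. *)
  have -> : (1 + 33 / 25 * (2 * (1 - v))) * (v * v) - 1 =
    (1 - v) * ((v - 5 / 6) * (66 / 25 * v + 6 / 5)) by field.
  rewrite !mulr_ge0 //; lra.
lra.
Qed.

(** From [exp_le_inv], [exp (y / (1 + y)) <= 1 + y], because [1 - y / (1 + y) = 1 / (1 + y)]. *)
Lemma pow_ge_exp (y : R) N : 0 <= y -> exp (N%:R * (y / (1 + y))) <= (1 + y) ^+ N.
Proof.
move=> y0; rewrite mulr_natl -expRX; apply: lerXn2r; rewrite ?nnegrE ?(ltW (exp_gt0 _)) //.
  by rewrite addr_ge0.
apply: le_trans (exp_le_inv _) _; first by rewrite ltr_pdivrMr; lra.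
have -> : 1 - y / (1 + y) = (1 + y)^-1 by field; rewrite gt_eqF //; lra.
by rewrite invrK.
Qed.

(** [N] times the coefficient of [u u^T] in one step of the matrix [U]: the prefix part always gains
    [u u^T], the sample part gains [u u^T / p] if the row is kept. *)
Definition sampling_shift (th xi p sg : R) (kept : bool) : R :=
  if kept then sg * th * (p^-1 - 1) - xi else - (sg * th) - xi.

(** Factoring out the exponential of the dropped case leaves one variable [x], with
    [|x| <= 2/3 eps <= 1/3] by [c h <= p]. Its first-order term cancels against [sg th], and the
    second-order term of [exp_le_quad] is at most [h / a * xi]. The constants are tuned by
    [(33/50) / (99/100) = 2/3] and [33/50 * 2/3 = 11/25]. If [p = 1] only the drift [- xi]
    remains. *)
Lemma exp_shift_mean (c eps h p sg : R) :
  let a := 99 / 100 in let th := 33 / 50 * (c * eps) in let xi := 11 / 25 * (th * eps) in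
  0 < c -> 0 < eps <= 1 / 2 -> 0 <= h -> 0 < p <= 1 -> (p = 1 \/ c * h <= p) ->
  (sg = 1 \/ sg = -1) ->
  p * exp (h / a * sampling_shift th xi p sg true) +
  (1 - p) * exp (h / a * sampling_shift th xi p sg false) <= 1.
Proof.
move=> a th xi c0 /andP[e0 e2] h0 /andP[p0 p1] hp sg1.
have th0 : 0 < th by rewrite /th; nra.
have xi0 : 0 < xi by rewrite /xi; nra.
have [pe|pn1] := eqVneq p 1.
  rewrite pe /sampling_shift subrr mul0r addr0 mul1r invr1 subrr mulr0 add0r.
  rewrite mulrN -[X in _ <= X]expR0; apply: ler_exp; rewrite oppr_le0.
  by rewrite mulr_ge0 ?(ltW xi0) // divr_ge0 // /a; lra.
case: hp => [/eqP|ch]; first by rewrite (negPf pn1).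
set x := sg * (h * th / (a * p)).
have xn : `|x| = h * th / (a * p).
  have r0 : 0 <= h * th / (a * p).
    by rewrite divr_ge0 // ?mulr_ge0 ?(ltW th0) ?(ltW p0) // /a; lra.
  by rewrite normrM (ger0_norm r0); case: sg1 => ->; rewrite ?normrN1 ?normr1 mul1r.
have xb : `|x| <= 2 / 3 * eps.
  rewrite xn ler_pdivrMr; last by rewrite /a; nra.
  have -> : h * th = 33 / 50 * eps * (c * h) by rewrite /th; ring.
  have : eps * (c * h) <= eps * p by rewrite ler_pM2l.
  rewrite /a; lra.
have x13 : `|x| <= 1 / 3 by lra.
set w := exp (h / a * (- (sg * th) - xi)).
have w0 : 0 < w by apply: exp_gt0.
have E1 : exp (h / a * sampling_shift th xi p sg true) = exp x * w.
  by rewrite expRD; congr exp; rewrite /sampling_shift /x /a RplusE; field; rewrite gt_eqF.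
rewrite E1 /sampling_shift -/w mulrA -mulrDl.
have wE : w = (exp (h / a * (sg * th + xi)))^-1.
  by rewrite -RinvE -exp_Ropp RoppE -mulrN opprD.
rewrite wE ler_pdivrMr ?exp_gt0 // mul1r.
apply: le_trans (exp_ge1Dx _).
have hx := exp_le_quad x13.
have : p * exp x <= p * (1 + x + 33 / 50 * x ^+ 2) by rewrite ler_pM2l.
have xx : x ^+ 2 <= `|x| * (2 / 3 * eps).
  by rewrite -real_normK ?num_real // expr2 ler_wpM2l.
have px : p * `|x| = h / a * th by rewrite xn /a; field; rewrite gt_eqF.
have pxs : p * x = h / a * (sg * th) by rewrite /x /a; field; rewrite gt_eqF.
have : p * x ^+ 2 <= h / a * th * (2 / 3 * eps).
  by rewrite -px -mulrA ler_pM2l.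
rewrite (mulrDr (h / a)) -pxs.
have -> : h / a * xi = 33 / 50 * (h / a * th * (2 / 3 * eps)) by rewrite /xi /a; field.
set r := h / a * th * _; set q := p * x ^+ 2 => h1 h2.
have E2 : p * (1 + x + 33 / 50 * x ^+ 2) = p + p * x + 33 / 50 * q by rewrite /q; ring.
rewrite E2 in h2; lra.
Qed.

(** [trace_rank1_update] bounds both outcomes with one [K], and [exp_shift_mean] averages them. The
    slack [(th / c + th + xi) / N] in the lower bound on [U] pays for a negative shift, so that the
    updated matrices stay above [a]. *)
Lemma sampling_step (d m : nat) (U : 'M[R]_d) (u : 'cV[R]_d) (c eps p sg : R) :
  let N := m.+1%:R in let a := 99 / 100 in
  let th := 33 / 50 * (c * eps) in let xi := 11 / 25 * (th * eps) in
  let U' b := U + (sampling_shift th xi p sg b / N) *: (u *m u^T) in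
  0 < c -> 0 < eps <= 1 / 2 -> ip u u <= 1 -> 0 < p <= 1 -> (p = 1 \/ c * ip u u <= p) ->
  (sg = 1 \/ sg = -1) -> U^T = U ->
  (forall x : 'cV_d, (a + (th / c + th + xi) / N) * ip x x <= ip x (U *m x)) ->
  p * \tr (U' true ^+ m.+1) + (1 - p) * \tr (U' false ^+ m.+1) <= \tr (U ^+ m.+1).
Proof.
move=> N a th xi U' c0 e02 h1 p01 hp sg1 sU Ua; have [e0 e2] := andP e02.
have [p0 p1] := andP p01.
have th0 : 0 < th by rewrite /th; nra.
have xi0 : 0 < xi by rewrite /xi; nra.
have N0 : 0 < N :> R by rewrite ltr0Sn.
have thc : 0 <= th / c by rewrite divr_ge0 ?ltW.
have a0 : 0 < a by rewrite /a; lra.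
have Ua' : forall x : 'cV_d, a * ip x x <= ip x (U *m x).
  move=> x; apply: le_trans (Ua x); rewrite ler_wpM2r ?ip_ge0 // lerDl.
  by apply: divr_ge0; [rewrite addr_ge0 ?(ltW xi0) // addr_ge0 ?(ltW th0) | exact: ltW].
have [K [K0 HK]] := trace_rank1_update m u sU a0 Ua'.
(* The dropped outcome matters only for [p != 1]; otherwise its weight [1 - p] is 0. *)
have U'a b : (b = false -> p != 1) -> forall x : 'cV_d, a * ip x x <= ip x (U' b *m x).
  move=> bp x; rewrite mulmxDl ipDr -scalemxAl ipZr ip_outer.
  have CS : ip x u * ip u x <= ip u u * ip x x.
    by have := ip_CS u x; rewrite expr2 (ipC x u).
  have := Ua x; rewrite mulrDl => hU.
  rewrite -lerBlDr; apply: le_trans hU; rewrite lerD2l.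
  rewrite -mulNr -mulNr mulrAC [leRHS]mulrAC; apply: ler_wpM2r.
    by rewrite invr_ge0 ltW.
  have q0 : 0 <= ip x u * ip u x by rewrite (ipC u x) -expr2 sqr_ge0.
  set q := ip x u * ip u x in CS q0 *; set h := ip u u in CS h1 hp *.
  set X := ip x x in CS *.
  have X0 : 0 <= X by apply: ip_ge0.
  have h0 : 0 <= h by apply: ip_ge0.
  have qX : q <= X by apply: le_trans CS _; nra.
  (* The worst negative shift comes from [sg = -1] for a kept row and from [sg = 1] for a dropped
     one. *)
  have sb : - sampling_shift th xi p sg b <= xi + (if b then (if p == 1 then 0 else th / p) else th).
    rewrite /sampling_shift; case: b bp => _.
      have [->|pn] := eqVneq p 1; first by rewrite invr1; lra.
      have pi : 1 <= p^-1 by rewrite invf_ge1.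
      by case: sg1 => ->; nra.
    by case: sg1 => ->; lra.
  apply: le_trans (_ : (xi + (if b then (if p == 1 then 0 else th / p) else th)) * q <= _).
    exact: ler_wpM2r.
  have t1 : th * q <= th * X by rewrite ler_pM2l.
  have t2 : xi * q <= xi * X by rewrite ler_pM2l.
  have t3 : 0 <= th / c * X by rewrite mulr_ge0.
  have t4 : 0 <= th * X by nra.
  case: b {bp sb}; last by nra.
  have [pe|pn] := eqVneq p 1; first by nra.
  case: hp => [/eqP|ch]; first by rewrite (negPf pn).
  have : th / p * q <= th / c * X.
    rewrite -(mulrA th) -(mulrA th) (ler_pM2l th0) mulrC ler_pdivrMr //.
    apply: le_trans CS _; rewrite mulrAC; apply: ler_wpM2r => //.
    by rewrite mulrC ler_pdivlMr // mulrC.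
  nra.
have HKb b : (b = false -> p != 1) -> \tr (U' b ^+ m.+1) <= \tr (U ^+ m.+1) +
    K * (exp (ip u u / a * sampling_shift th xi p sg b) - 1).
  move=> bp; have := HK _ (U'a b bp).
  have X (N' x y : R) : N' != 0 -> N' * x / a * (y / N') = x / a * y.
    by move=> N1; rewrite /a; field.
  by rewrite X // gt_eqF.
have M := exp_shift_mean c0 e02 (ip_ge0 u) p01 hp sg1.
rewrite -/a -/th -/xi in M.
have T1 : p * \tr (U' true ^+ m.+1) <= p * (\tr (U ^+ m.+1) +
    K * (exp (ip u u / a * sampling_shift th xi p sg true) - 1)).
  by rewrite ler_pM2l //; apply: HKb.
have T2 : (1 - p) * \tr (U' false ^+ m.+1) <= (1 - p) * (\tr (U ^+ m.+1) +
    K * (exp (ip u u / a * sampling_shift th xi p sg false) - 1)).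
  have [pe|pn] := eqVneq p 1; first by rewrite pe subrr !mul0r.
  by apply: ler_wpM2l; [rewrite subr_ge0 | apply: HKb].
apply: le_trans (lerD T1 T2) _; move: M.
set e1 := exp _; set e2' := exp _ => M; set t := \tr _.
have -> : p * (t + K * (e1 - 1)) + (1 - p) * (t + K * (e2' - 1)) =
  t + K * (p * e1 + (1 - p) * e2' - 1) by ring.
by rewrite gerDl; apply: mulr_ge0_le0 => //; rewrite subr_le0.
Qed.

(** * Matrices as functions and leverage scores *)

Definition cv d (x : vec) : 'cV[R]_d := \col_i x i.
Definition mx_of m n (M : mat) : 'M[R]_(m, n) := \matrix_(i, j) M i j.
Definition vec_of d (x : 'cV[R]_d) : vec := fun i => if insub i is Some k then x k 0 else 0.
Definition mat_of m n (M : 'M[R]_(m, n)) : mat :=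
  fun i j => if insub i is Some k then if insub j is Some l then M k l else 0 else 0.

Lemma vec_ofK d (x : 'cV[R]_d) : cv d (vec_of x) = x.
Proof. by apply/colP => i; rewrite mxE /vec_of valK. Qed.

Lemma mat_ofK m n (M : 'M[R]_(m, n)) : mx_of m n (mat_of M) = M.
Proof. by apply/matrixP => i j; rewrite mxE /mat_of !valK. Qed.

Lemma sumRE n f : sumR n f = \sum_(i < n) f i.
Proof. by elim: n => [|n IH] /=; rewrite ?big_ord0 // big_ord_recr /= IH. Qed.

Lemma dotE d x y : dot d x y = ip (cv d x) (cv d y).
Proof. by rewrite /dot sumRE; apply: eq_bigr => i _; rewrite !mxE. Qed.

Lemma mat_applyE m d M x : cv m (mat_apply d M x) = mx_of m d M *m cv d x.
Proof.
apply/colP => i; rewrite !mxE /mat_apply sumRE.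
by apply: eq_bigr => j _; rewrite !mxE.
Qed.

Lemma quadE d M x : quad d M x = ip (cv d x) (mx_of d d M *m cv d x).
Proof. by rewrite /quad dotE mat_applyE. Qed.

Lemma matmulE d X Y : mx_of d d (matmul d X Y) = mx_of d d X *m mx_of d d Y.
Proof.
apply/matrixP => i j; rewrite !mxE /matmul sumRE.
by apply: eq_bigr => k _; rewrite !mxE.
Qed.

Lemma transpE d X : mx_of d d (transp X) = (mx_of d d X)^T.
Proof. by apply/matrixP => i j; rewrite !mxE. Qed.

Lemma mat_eqE d X Y : mat_eq d X Y <-> mx_of d d X = mx_of d d Y.
Proof.
split=> [h|h i j /ssrnat.ltP id /ssrnat.ltP jd].
  by apply/matrixP => i j; rewrite !mxE; apply: h; apply/ssrnat.ltP.
by have := congr1 (fun M : 'M[R]_d => M (Ordinal id) (Ordinal jd)) h; rewrite !mxE.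
Qed.

Definition gram_prefix d (A : mat) i : 'M[R]_d :=
  \sum_(j < i) cv d (Defs.row A j) *m (cv d (Defs.row A j))^T.
Definition gram_seq d (L : list vec) : 'M[R]_d := \sum_(b <- L) cv d b *m (cv d b)^T.

Lemma gramE d k A : mx_of d d (gram k A) = gram_prefix d A k.
Proof.
apply/matrixP => i j; rewrite mxE /gram sumRE summxE; apply: eq_bigr => l _.
by rewrite !mxE big_ord1 !mxE.
Qed.

Lemma gramLE d L : mx_of d d (gramL L) = gram_seq d L.
Proof.
rewrite /gramL gramE /gram_seq (big_nth (fun=> 0)) big_mkord.
have nthE (n : nat) (l : list vec) : List.nth n l (fun=> 0) = nth (fun=> 0) l n.
  by elim: n l => [|n IH] [|x l] //=.
apply: eq_bigr => i _; rewrite -nthE.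
by have -> : cv d (Defs.row (mat_of_rows L) i) = cv d (List.nth i L (fun=> 0)).
Qed.

Lemma gram_prefixS d A i : gram_prefix d A i.+1 =
  gram_prefix d A i + cv d (Defs.row A i) *m (cv d (Defs.row A i))^T.
Proof. by rewrite /gram_prefix big_ord_recr. Qed.

Lemma trmx_sum_outer (F : rcfType) d (I : Type) (s : seq I) (f : I -> 'cV[F]_d) :
  (\sum_(i <- s) f i *m (f i)^T)^T = \sum_(i <- s) f i *m (f i)^T.
Proof. by rewrite raddf_sum; apply: eq_bigr => i _; rewrite /= trmx_outer. Qed.

Lemma quad_sum_outer (F : rcfType) d (I : Type) (s : seq I) (f : I -> 'cV[F]_d) x :
  ip x ((\sum_(i <- s) f i *m (f i)^T) *m x) = \sum_(i <- s) ip (f i) x ^+ 2.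
Proof.
rewrite ipE mulmx_suml mulmx_sumr summxE; apply: eq_bigr => i _.
by rewrite -ipE ip_outer ipC expr2.
Qed.

Lemma gram_prefix_sym d A i : (gram_prefix d A i)^T = gram_prefix d A i.
Proof. exact: trmx_sum_outer. Qed.

Lemma gram_seq_sym d L : (gram_seq d L)^T = gram_seq d L.
Proof. exact: trmx_sum_outer. Qed.

Lemma gram_prefix_psd d A i : psd (gram_prefix d A i).
Proof. by move=> x; rewrite quad_sum_outer sumr_ge0 // => j _; rewrite sqr_ge0. Qed.

Lemma gram_seq_psd d L : psd (gram_seq d L).
Proof. by move=> x; rewrite quad_sum_outer sumr_ge0 // => j _; rewrite sqr_ge0. Qed.

Lemma gram_prefix_quad_le d A i n x : (i <= n)%N ->
  ip x (gram_prefix d A i *m x) <= ip x (gram_prefix d A n *m x).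
Proof.
elim: n => [|n IH]; first by rewrite leqn0 => /eqP ->.
rewrite leq_eqVlt => /orP[/eqP ->//|]; rewrite ltnS => /IH h.
rewrite gram_prefixS mulmxDl ipDr ip_outer; apply: le_trans h _.
by rewrite lerDl ipC -expr2 sqr_ge0.
Qed.

(** A vector of the kernel annihilates the sum of the squares [(a_j^T z)^2], hence each of them. *)
Lemma gram_prefix_ker d A n j z : (j < n)%N -> gram_prefix d A n *m z = 0 ->
  ip (cv d (Defs.row A j)) z = 0.
Proof.
move=> jn h; apply/eqP; rewrite -sqrf_eq0 eq_le sqr_ge0 andbT.
rewrite -[X in _ <= X](ip0r z) -h. apply: le_trans _ (gram_prefix_quad_le A z jn).
rewrite gram_prefixS mulmxDl ipDr ip_outer ipC -expr2 lerDr; exact: gram_prefix_psd.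
Qed.

Lemma gram_prefix_ker_mono d A i n (z : 'cV_d) : (i <= n)%N -> gram_prefix d A n *m z = 0 ->
  gram_prefix d A i *m z = 0.
Proof.
move=> i_n Gz; apply: psd_ker (gram_prefix_sym d A i) (@gram_prefix_psd d A i) _.
apply/eqP; rewrite eq_le gram_prefix_psd andbT.
by apply: le_trans (gram_prefix_quad_le A z i_n) _; rewrite Gz ip0r.
Qed.

(** The residual [a - M X a] lies in the kernel of [M], so it is orthogonal to [a] and to the range
    of [M], hence to itself. *)
Lemma sym_pinv_range (F : rcfType) n (M X : 'M[F]_n) (a : 'cV_n) : M^T = M ->
  M *m X *m M = M -> (M *m X)^T = M *m X ->
  (forall z, M *m z = 0 -> ip a z = 0) -> M *m (X *m a) = a.
Proof.
move=> sM h1 h3 ha; pose w := a - M *m (X *m a).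
have MMX : M *m (M *m X) = M.
  have -> : M *m X = X^T *m M by rewrite -h3 trmx_mul sM.
  transitivity ((M *m X *m M)^T); last by rewrite h1 sM.
  by rewrite !trmx_mul sM.
have Mw : M *m w = 0 by rewrite mulmxBr !mulmxA -[X in _ - X *m _]mulmxA MMX subrr.
have : ip w w = 0.
  by rewrite {1}/w ipBl ha // ip_mull sM Mw ip0r subrr.
by move/eqP; rewrite ip_eq0 subr_eq0 => /eqP.
Qed.

Lemma pinvP d (M : mat) : (mx_of d d M)^T = mx_of d d M ->
  let X := mx_of d d (pinv d M) in let M := mx_of d d M in
  [/\ M *m X *m M = M, X *m M *m X = X, (M *m X)^T = M *m X & (X *m M)^T = X *m M].
Proof.
move=> sM X M'; have : is_pinv d M (pinv d M).
  apply: epsilon_spec; have [Z [h1 h2 h3 h4]] := sym_pinv_exists sM.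
  exists (mat_of Z); split; [|split; [|split]]; apply/mat_eqE.
  - by rewrite 2!matmulE mat_ofK h1.
  - by rewrite 2!matmulE mat_ofK h2.
  - by rewrite transpE matmulE mat_ofK h3.
  - by rewrite transpE matmulE mat_ofK h4.
case=> [/mat_eqE h1 [/mat_eqE h2 [/mat_eqE h3 /mat_eqE h4]]].
rewrite 2!matmulE in h1; rewrite 2!matmulE in h2.
rewrite transpE matmulE in h3; rewrite transpE matmulE in h4.
by split.
Qed.

(** Trades the pseudo-inverse for a solution [x] of [M x = b] orthogonal to the kernel of [M]. The
    equation is solvable because [b b^T] is a nonnegative part of [M], so that the kernel of [M] is
    orthogonal to [b]. *)
Lemma lev_scoreP d S a : let b := cv d a in let M := gram_seq d S + b *m b^T in
  exists x, [/\ M *m x = b, ip b x = lev_score d S a &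
                forall z, M *m z = 0 -> ip x z = 0].
Proof.
move=> b M; have ME : mx_of d d (madd (gramL S) (outer a)) = M.
  by apply/matrixP => i j; rewrite /M -gramLE !mxE big_ord1 !mxE.
have sM : M^T = M by rewrite linearD /= gram_seq_sym trmx_outer.
have := @pinvP d (madd (gramL S) (outer a)).
rewrite ME; set X := mx_of d d (pinv d _) => /(_ sM)[h1 h2 h3 h4].
exists (X *m b); split.
- apply: sym_pinv_range => // z Mz.
  have := congr1 (ip z) Mz; rewrite ip0r mulmxDl ipDr ip_outer => /eqP.
  rewrite paddr_eq0 ?gram_seq_psd // => [/andP[_]|]; last by rewrite ipC -expr2 sqr_ge0.
  by rewrite ipC mulf_eq0 orbb => /eqP.
- by rewrite /lev_score quadE.
- move=> z Mz; have [w ->] := pinv_range sM h1 h2 h3 h4 b.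
  by rewrite ip_mull sM Mz ip0r.
Qed.

(** With [t = b^T x], the equation gives [t = x^T M x = x^T G_S x + t^2 >= t^2]. *)
Lemma lev_score_range d S a : 0 <= lev_score d S a <= 1.
Proof.
have [x [h1 h2 _]] := lev_scoreP d S a; rewrite -h2.
have := congr1 (ip x) h1; rewrite mulmxDl ipDr ip_outer (ipC x (cv d a)) => E.
have := @gram_seq_psd d S x; set t := ip (cv d a) x in E * => h; apply/andP; split; nra.
Qed.

(** * The supermartingale *)

(** The sum defining [alg_prob] with a real function in place of the indicator, started at any row
    and sample so that induction over the remaining rows applies. *)
Definition alg_expect d (eps : R) (A : mat) m i (S : list vec) (F : list vec -> R) : R :=
  fold_right Rplus 0 (List.map (fun bs => let res := alg_run d eps A i S bs in
                        snd res * F (fst res)) (all_bools m)).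

Definition keep_row d (eps : R) (A : mat) i (S : list vec) : list vec :=
  (S ++ [:: vscale (Rinv (sqrt (samp_prob d eps S (Defs.row A i)))) (Defs.row A i)])%list.

Lemma alg_expect0 d eps A i S F : alg_expect d eps A 0 i S F = F S.
Proof. by rewrite /alg_expect /= !RealsE mul1r addr0. Qed.

Lemma alg_expectS d eps A m i S F : alg_expect d eps A m.+1 i S F =
  let p := samp_prob d eps S (Defs.row A i) in
  p * alg_expect d eps A m i.+1 (keep_row d eps A i S) F +
  (1 - p) * alg_expect d eps A m i.+1 S F.
Proof.
have sum_cat (l1 l2 : list R) : fold_right Rplus 0 (l1 ++ l2)%list =
    fold_right Rplus 0 l1 + fold_right Rplus 0 l2.
  by elim: l1 => [|x l1 /= ->]; rewrite ?add0r // RplusE addrA.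
have sum_scale (I : Type) (l : list I) (r : R) (f g : I -> R) : (forall x, f x = r * g x) ->
    fold_right Rplus 0 (List.map f l) = r * fold_right Rplus 0 (List.map g l).
  by move=> fg; elim: l => [|x l /= ->]; rewrite ?mulr0 // RplusE mulrDr fg.
rewrite /alg_expect [all_bools _]/= List.map_app sum_cat !List.map_map /=.
by congr (_ + _); apply: sum_scale => bs /=; rewrite RmultE mulrA.
Qed.

Lemma alg_expect_compl d eps A m i S F :
  alg_expect d eps A m i S (fun L => 1 - F L) = 1 - alg_expect d eps A m i S F.
Proof.
elim: m i S => [|m IH] i S; first by rewrite !alg_expect0.
by rewrite !alg_expectS /= !IH; ring.
Qed.

(** Induction over the remaining rows for a supermartingale [V]. The invariant is required only
    after outcomes of positive probability. *)
Lemma alg_expect_le d eps A n (Inv : nat -> list vec -> Prop) V F :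
  (forall S, Inv n S -> F S <= V n S) ->
  (forall i S, (i < n)%N -> Inv i S -> let p := samp_prob d eps S (Defs.row A i) in
    [/\ 0 <= p <= 1, 0 < p -> Inv i.+1 (keep_row d eps A i S), p < 1 -> Inv i.+1 S &
      p * V i.+1 (keep_row d eps A i S) + (1 - p) * V i.+1 S <= V i S]) ->
  forall m i S, (m + i = n)%N -> Inv i S -> alg_expect d eps A m i S F <= V i S.
Proof.
move=> FV step; elim=> [|m IH] i S.
  by rewrite add0n => ->; rewrite alg_expect0; apply: FV.
move=> min Inv_i; have i_n : (i < n)%N by rewrite -min addSn ltnS leq_addl.
have [/andP[p0 p1] I1 I2 h] := step i S i_n Inv_i.
rewrite alg_expectS /=; apply: le_trans h; apply: lerD.
  have [->|pn] := eqVneq (samp_prob d eps S (Defs.row A i)) 0; first by rewrite !mul0r.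
  apply: ler_wpM2l => //; apply: IH; first by rewrite addnS -addSn.
  by apply: I1; rewrite lt_def pn.
have [->|pn] := eqVneq (samp_prob d eps S (Defs.row A i)) 1; first by rewrite subrr !mul0r.
apply: ler_wpM2l; first by rewrite subr_ge0.
apply: IH; first by rewrite addnS -addSn.
by apply: I2; rewrite lt_neqAle pn.
Qed.

Lemma samp_probE d eps S a : samp_prob d eps S a =
  Num.min (c_param d eps * Num.min ((1 + eps) * lev_score d S a) 1) 1.
Proof. by rewrite /samp_prob !RminE. Qed.

Lemma samp_prob_range d eps S a : 0 <= eps -> 0 <= c_param d eps ->
  0 <= samp_prob d eps S a <= 1.
Proof.
move=> e0 c0; have /andP[l0 _] := lev_score_range d S a; rewrite samp_probE.
rewrite ge_min lexx orbT andbT le_min ler01 andbT mulr_ge0 // le_min ler01 andbT.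
by rewrite mulr_ge0 // addr_ge0.
Qed.

Lemma gram_seq_keep d eps A i S : let p := samp_prob d eps S (Defs.row A i) in
  0 < p -> gram_seq d (keep_row d eps A i S) = gram_seq d S +
    p^-1 *: (cv d (Defs.row A i) *m (cv d (Defs.row A i))^T).
Proof.
move=> p p0; rewrite /gram_seq /keep_row -/p -[List.app _ _]/(S ++ _) big_cat big_seq1 /=.
congr (_ + _).
have -> : cv d (vscale (Rinv (sqrt p)) (Defs.row A i)) =
    (Num.sqrt p)^-1 *: cv d (Defs.row A i).
  by apply/colP => j; rewrite !mxE /vscale !RealsE.
rewrite linearZ /= -scalemxAl -scalemxAr scalerA -invfM -expr2 sqr_sqrtr //.
exact: ltW.
Qed.

(** * The potential in isotropic coordinates *)

Lemma quad_ker_congr (F : rcfType) d (M : 'M[F]_d) x y : M^T = M -> M *m (x - y) = 0 ->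
  ip x (M *m x) = ip y (M *m y).
Proof.
move=> sM; rewrite mulmxBr => /eqP; rewrite subr_eq0 => /eqP E.
have sw : ip x (M *m y) = ip y (M *m x) by rewrite ip_mulr sM ipC.
by rewrite E sw E.
Qed.

Definition conj_mx (F : rcfType) d (T M : 'M[F]_d) := T^T *m M *m T.

Lemma conj_mx_quad (F : rcfType) d (T M : 'M[F]_d) y :
  ip y (conj_mx T M *m y) = ip (T *m y) (M *m (T *m y)).
Proof. by rewrite /conj_mx -!mulmxA ip_mulr trmxK. Qed.

Lemma conj_mxD (F : rcfType) d (T M1 M2 : 'M[F]_d) :
  conj_mx T (M1 + M2) = conj_mx T M1 + conj_mx T M2.
Proof. by rewrite /conj_mx mulmxDr mulmxDl. Qed.

Lemma conj_mx_outer (F : rcfType) d (T : 'M[F]_d) r (b : 'cV_d) :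
  conj_mx T (r *: (b *m b^T)) = r *: (T^T *m b *m (T^T *m b)^T).
Proof. by rewrite /conj_mx -scalemxAr -scalemxAl trmx_mul trmxK !mulmxA. Qed.

Lemma conj_mx_sym (F : rcfType) d (T M : 'M[F]_d) : M^T = M ->
  (conj_mx T M)^T = conj_mx T M.
Proof. by move=> sM; rewrite /conj_mx !trmx_mul trmxK sM mulmxA. Qed.

Definition potential_mx d (A : mat) (T : 'M[R]_d) (N th xi sg : R) i S : 'M[R]_d :=
  1%:M + N^-1 *: ((sg * th) *: (conj_mx T (gram_seq d S) - conj_mx T (gram_prefix d A i))
                  - xi *: conj_mx T (gram_prefix d A i)).

Lemma potential_mx_sym d A T N th xi sg i S :
  (@potential_mx d A T N th xi sg i S)^T = potential_mx A T N th xi sg i S.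
Proof.
rewrite /potential_mx linearD linearZ linearB !linearZ linearB /= trmx1.
by rewrite !conj_mx_sym ?gram_seq_sym ?gram_prefix_sym.
Qed.

Lemma potential_mx_quad d A T N th xi sg i S y :
  ip y (@potential_mx d A T N th xi sg i S *m y) = ip y y +
    (sg * th * (ip (T *m y) (gram_seq d S *m (T *m y)) -
                ip (T *m y) (gram_prefix d A i *m (T *m y)))
     - xi * ip (T *m y) (gram_prefix d A i *m (T *m y))) / N.
Proof.
rewrite /potential_mx mulmxDl mul1mx ipDr -scalemxAl ipZr mulmxBl ipBr.
rewrite -!scalemxAl !ipZr mulmxBl ipBr !conj_mx_quad; ring.
Qed.

Lemma potential_mx_step d A T N th xi sg i S S' r :
  let b := cv d (Defs.row A i) in
  gram_seq d S' = gram_seq d S + r *: (b *m b^T) ->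
  potential_mx A T N th xi sg i.+1 S' = potential_mx A T N th xi sg i S +
    ((sg * th * (r - 1) - xi) / N) *: (T^T *m b *m (T^T *m b)^T).
Proof.
move=> b E.
have E1 : conj_mx T (b *m b^T) = T^T *m b *m (T^T *m b)^T.
  by rewrite -[b *m b^T]scale1r conj_mx_outer scale1r.
rewrite /potential_mx E gram_prefixS !conj_mxD conj_mx_outer E1.
move: (T^T *m b *m _) (conj_mx T (gram_seq d S)) (conj_mx T (gram_prefix d A i)) => Q Y Z.
rewrite -[RHS]addrA; congr (_ + _).
apply/matrixP => k l; rewrite !mxE; ring.
Qed.

(** The sign [sg = 1] watches the upper and [sg = -1] the lower spectral bound; the sum controls
    both at once. *)
Definition potential d (A : mat) (T : 'M[R]_d) (m : nat) (th xi : R) i S : R :=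
  \tr (potential_mx A T m%:R th xi 1 i S ^+ m) + \tr (potential_mx A T m%:R th xi (-1) i S ^+ m).

Definition isotropic d (G T : 'M[R]_d) : Prop :=
    [/\ forall y, ip (T *m y) (G *m (T *m y)) <= ip y y,
        forall x, exists y, ip y y = ip x (G *m x) /\ G *m (x - T *m y) = 0 &
        forall a, (forall z, G *m z = 0 -> ip a z = 0) ->
          G *m (T *m (T^T *m a)) = a].

(** By contraposition: a direction violating the bound becomes, through [T], a unit vector [w] with
    [w^T U w >= 1 + (th eps - xi) / m]; [quad_pow2_le] raises this to the power [m] and
    [trace_even_ge] passes to the trace. The trace for the other sign is nonnegative, since [m] is
    even. *)
Lemma potential_small_good d A T k (th eps xi : R) n i S (x : 'cV[R]_d) :
  let G := gram_prefix d A n in let m := (2 ^ k.+1)%N in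
  isotropic G T -> (i <= n)%N -> (forall z : 'cV_d, G *m z = 0 -> gram_seq d S *m z = 0) ->
  0 <= xi -> 0 < th -> xi <= th * eps ->
  potential A T m th xi i S < (1 + (th * eps - xi) / m%:R) ^+ m ->
  forall sg, sg = 1 \/ sg = -1 ->
  sg * (ip x (gram_seq d S *m x) - ip x (gram_prefix d A i *m x)) <= eps * ip x (G *m x).
Proof.
move=> G m [T1 T2 T3] i_n kS xi0 th0 xe Wsmall sg sg1.
have [y [yy Gxy]] := T2 x.
have GSE := quad_ker_congr (gram_seq_sym d S) (kS _ Gxy).
have GiE := quad_ker_congr (gram_prefix_sym d A i) (gram_prefix_ker_mono i_n Gxy).
rewrite GSE GiE -yy leNgt; apply/negP => bad.
have m0 : 0 < m%:R :> R by rewrite ltr0n expn_gt0.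
have y0 : y != 0.
  by apply/eqP => y0; move: bad; rewrite y0 !mulmx0 !ip0r subrr !mulr0 ltxx.
have yy0 : 0 < ip y y by rewrite ip_gt0.
pose s := Num.sqrt (ip y y).
have ss : s ^+ 2 = ip y y by rewrite sqr_sqrtr // ltW.
have s0 : s != 0 by rewrite sqrtr_eq0 -ltNge.
pose w := s^-1 *: y.
have ww : ip w w = 1 by rewrite /w ipZl ipZr -ss; field.
pose U := potential_mx A T m%:R th xi sg i S.
have sU : U^T = U by apply: potential_mx_sym.
have r0 : 0 <= 1 + (th * eps - xi) / m%:R.
  by rewrite addr_ge0 // divr_ge0 ?(ltW m0) // subr_ge0.
have Uw : 1 + (th * eps - xi) / m%:R <= ip w (U *m w).
  rewrite potential_mx_quad ww lerD2l ler_pM2r ?invr_gt0 //.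
  have sc M : ip (T *m w) (M *m (T *m w)) = ip (T *m y) (M *m (T *m y)) / ip y y.
    by rewrite /w -!scalemxAr ipZl ipZr -ss; field.
  have rG : ip (T *m w) (gram_prefix d A i *m (T *m w)) <= 1.
    apply: le_trans (gram_prefix_quad_le A _ i_n) _.
    by apply: le_trans (T1 w) _; rewrite ww.
  have q : eps <= sg * (ip (T *m w) (gram_seq d S *m (T *m w)) -
                ip (T *m w) (gram_prefix d A i *m (T *m w))).
    by rewrite !sc -mulrBl mulrA ler_pdivlMr // ltW.
  rewrite (mulrC sg) -mulrA; apply: lerB; first by rewrite ler_pM2l.
  by rewrite -[leRHS]mulr1; apply: ler_wpM2l.
have mE : m = (2 ^ k).*2 by rewrite /m expnS mul2n.
have B1 := quad_pow2_le k.+1 sU ww r0 Uw.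
have B2 := trace_even_ge (2 ^ k) sU ww; rewrite -mE in B2.
have B3 sg' : 0 <= \tr (potential_mx A T m%:R th xi sg' i S ^+ m).
  by rewrite mE; apply: trace_even_ge0; apply: potential_mx_sym.
move: Wsmall; rewrite ltNge => /negP; apply; apply: le_trans B1 _.
apply: le_trans B2 _; rewrite /U /potential.
by case: sg1 => ->; [rewrite lerDl | rewrite lerDr].
Qed.

(** The vector [y = T u] solves [G y = b] and has [b^T y = y^T G y = |u|^2]. The spectral bound
    gives [y^T M y <= (1 + eps) |u|^2] for [M = G_S + b b^T], and Cauchy-Schwarz against the
    solution [x] of [M x = b] turns this into [|u|^2 <= (1 + eps) t], with [t] the leverage
    score. *)
Lemma samp_prob_ge d A T n i S (eps : R) :
  let G := gram_prefix d A n in let a := Defs.row A i in let u := T^T *m cv d a in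
  isotropic G T -> (i < n)%N -> 0 <= eps -> 0 <= c_param d eps ->
  (forall x, ip x (gram_seq d S *m x) <= ip x (gram_prefix d A i *m x) + eps * ip x (G *m x)) ->
  ip u u <= 1 /\ (samp_prob d eps S a = 1 \/ c_param d eps * ip u u <= samp_prob d eps S a).
Proof.
move=> G a u [T1 T2 T3] i_n e0 c0 good; set b := cv d a in u *.
pose y := T *m u.
have Gy : G *m y = b by apply: T3 => z; apply: gram_prefix_ker.
have hE : ip u u = ip b y by rewrite /u ip_mull trmxK.
have yGy : ip y (G *m y) = ip u u by rewrite Gy ipC hE.
have h0 : 0 <= ip u u := ip_ge0 u.
have pre : ip y (gram_prefix d A i.+1 *m y) <= ip u u.
  by rewrite -yGy; apply: gram_prefix_quad_le.
rewrite gram_prefixS mulmxDl ipDr ip_outer -/b (ipC y b) -hE in pre.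
have preG := @gram_prefix_psd d A i y.
have h1 : ip u u <= 1 by nra.
split=> //; have [x [Mx bx _]] := lev_scoreP d S a; rewrite -/b in Mx bx.
set M := gram_seq d S + b *m b^T in Mx.
have sM : M^T = M by rewrite linearD /= gram_seq_sym trmx_outer.
have pM : psd M.
  move=> z; rewrite mulmxDl ipDr ip_outer (ipC z b) addr_ge0 ?gram_seq_psd //.
  by rewrite -expr2 sqr_ge0.
have My : ip y (M *m y) <= (1 + eps) * ip u u.
  have := good y; rewrite yGy mulmxDl ipDr ip_outer (ipC y b) -hE; lra.
have := psd_CS y x sM pM; rewrite Mx (ipC y b) -hE (ipC x b) bx.
set t := lev_score d S a in bx *; set h := ip u u in h0 h1 My * => CS.
have t0 : 0 <= t by have /andP[] := lev_score_range d S a.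
have ht : h <= (1 + eps) * t.
  have [->|hn] := eqVneq h 0; first by rewrite mulr_ge0 // addr_ge0.
  have hp : 0 < h by rewrite lt_def hn.
  have : h * h <= h * ((1 + eps) * t).
    rewrite -expr2; apply: le_trans CS _; rewrite mulrCA mulrA; exact: ler_wpM2r.
  by rewrite ler_pM2l.
rewrite samp_probE -/t; set c := c_param d eps in c0 *.
have : c * h <= c * Num.min ((1 + eps) * t) 1.
  by apply: ler_wpM2l => //; rewrite le_min ht.
by rewrite /Num.min; case: (ltP (c * _) 1) => _ hh; [right | left].
Qed.

(** Below the threshold [potential_small_good] holds in every direction; it supplies both the lower
    bound on the sampling probability and the lower bound on [U] that [sampling_step] needs, and the
    two signs are added. *)
Lemma potential_step d A T k (c eps : R) n i S :
  let G := gram_prefix d A n in let m := (2 ^ k.+1)%N in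
  let th := 33 / 50 * (c * eps) in let xi := 11 / 25 * (th * eps) in
  let p := samp_prob d eps S (Defs.row A i) in
  c = c_param d eps -> 0 < c -> 0 < eps <= 1 / 2 ->
  th * eps + xi + (th / c + th + xi) <= m%:R / 100 ->
  isotropic G T -> (i < n)%N -> (forall z : 'cV_d, G *m z = 0 -> gram_seq d S *m z = 0) ->
  potential A T m th xi i S < (1 + (th * eps - xi) / m%:R) ^+ m ->
  p * potential A T m th xi i.+1 (keep_row d eps A i S) +
  (1 - p) * potential A T m th xi i.+1 S <= potential A T m th xi i S.
Proof.
move=> G m th xi p cE c0 e02 mbig iso i_n kS W.
have [e0 e2] := andP e02.
have th0 : 0 < th by rewrite /th; nra.
have xi0 : 0 < xi by rewrite /xi; nra.
have xe : xi <= th * eps.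
  by have := mulr_gt0 th0 e0; rewrite /xi => ?; lra.
have m0 : 0 < m%:R :> R by rewrite ltr0n expn_gt0.
have good x := potential_small_good x iso (ltnW i_n) kS (ltW xi0) th0 xe W.
have good1 x : ip x (gram_seq d S *m x) <= ip x (gram_prefix d A i *m x) + eps * ip x (G *m x).
  by have := good x 1 (or_introl erefl); rewrite -/G; lra.
have [] := samp_prob_ge iso i_n (ltW e0) _ good1; first by rewrite -cE ltW.
rewrite -cE -/p; set b := cv d _; set u := T^T *m b => h1 hp.
have p01 : 0 <= p <= 1 by apply: samp_prob_range; rewrite ?(ltW e0) // -cE ltW.
suff main sg : sg = 1 \/ sg = -1 ->
  p * \tr (potential_mx A T m%:R th xi sg i.+1 (keep_row d eps A i S) ^+ m) +
  (1 - p) * \tr (potential_mx A T m%:R th xi sg i.+1 S ^+ m) <=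
  \tr (potential_mx A T m%:R th xi sg i S ^+ m).
  have add (x1 x2 y1 y2 z1 z2 : R) : p * x1 + (1 - p) * y1 <= z1 ->
      p * x2 + (1 - p) * y2 <= z2 -> p * (x1 + x2) + (1 - p) * (y1 + y2) <= z1 + z2.
    by move=> h1' h2'; rewrite !mulrDr addrACA; apply: lerD.
  exact: add (main 1 (or_introl erefl)) (main (-1) (or_intror erefl)).
move=> sg1.
have US : potential_mx A T m%:R th xi sg i.+1 S = potential_mx A T m%:R th xi sg i S +
    (sampling_shift th xi p sg false / m%:R) *: (u *m u^T).
  rewrite (@potential_mx_step _ _ _ _ _ _ _ i S S 0); last by rewrite scale0r addr0.
  by rewrite sub0r mulrN1.
(* Probability 0 forces [u = 0], and then the potential matrix does not move. *)
have [pz|pn0] := eqVneq p 0.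
  rewrite pz mul0r add0r subr0 mul1r US.
  have u0 : u = 0.
    apply/eqP; rewrite -ip_eq0; case: hp => [/eqP|]; first by rewrite pz eq_sym oner_eq0.
    by rewrite pz pmulr_rle0 // => h; rewrite eq_le h ip_ge0.
  by rewrite u0 mul0mx scaler0 addr0.
have p0 : 0 < p by rewrite lt_def pn0; case/andP: p01.
have UK : potential_mx A T m%:R th xi sg i.+1 (keep_row d eps A i S) =
    potential_mx A T m%:R th xi sg i S + (sampling_shift th xi p sg true / m%:R) *: (u *m u^T).
  by rewrite (potential_mx_step _ _ _ _ _ (gram_seq_keep p0)).
have mE : m = m.-1.+1 by rewrite prednK // expn_gt0.
rewrite US UK; move: (@sampling_step d m.-1 (potential_mx A T m%:R th xi sg i S) u c eps p sg).
rewrite -!mE -/th -/xi; apply => //; first by case/andP: p01 => _ ->; rewrite p0.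
  exact: potential_mx_sym.
move=> x; rewrite potential_mx_quad.
have iG := gram_prefix_quad_le A (T *m x) (ltnW i_n).
have [T1 _ _] := iso; have := T1 x.
(* The bound for the opposite sign keeps [sg (G_S - G_i)] from being too negative. *)
have g2 := good (T *m x) (- sg) _; rewrite -/G in g2 iG *.
have {}g2 := g2 _; move: g2 => /(_ _)/wrap[]; first by case: sg1 => ->; [right | left; rewrite opprK].
set X := ip x x; set Y := ip _ (G *m _); set Z := ip _ (gram_prefix _ _ _ *m _); set V := ip _ (gram_seq _ _ *m _).
rewrite -/Z -/Y in iG * => g2 YX; have X0 : 0 <= X := ip_ge0 x.
have Z0 : 0 <= Z := @gram_prefix_psd d A i (T *m x).
have mi : 0 < m%:R^-1 :> R by rewrite invr_gt0.
have b1 : - (th * eps * X) <= sg * th * (V - Z).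
  have : th * (- sg * (V - Z)) <= th * (eps * X).
    rewrite ler_pM2l //; apply: le_trans g2 _; rewrite ler_pM2l //.
  have -> : th * (- sg * (V - Z)) = - (sg * th * (V - Z)) by ring.
  rewrite mulrA; lra.
have b2 : xi * Z <= xi * X by rewrite ler_pM2l //; apply: le_trans iG YX.
rewrite mulrDl; set s := th / c + th + xi in mbig *.
(* Deviation and slack together cost at most [|x|^2 / 100], which leaves the 99/100 of
   [sampling_step]. *)
have b3 : (th * eps + xi + s) * X / m%:R <= X / 100.
  rewrite ler_pdivrMr //; apply: le_trans (ler_wpM2r X0 mbig) _.
  by rewrite le_eqVlt; apply/orP; left; apply/eqP; field.
have b4 : (- (th * eps * X) - xi * X) / m%:R <= (sg * th * (V - Z) - xi * Z) / m%:R.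
  by rewrite ler_pM2r // lerB.
apply: le_trans (_ : X + (- (th * eps * X) - xi * X) / m%:R <= _); last by rewrite lerD2l.
have b5 : (th * eps + xi + s) * X / m%:R = th * eps * X / m%:R + xi * X / m%:R + s / m%:R * X.
  by ring.
have b6 : (- (th * eps * X) - xi * X) / m%:R = - (th * eps * X / m%:R) - xi * X / m%:R by ring.
rewrite b5 in b3; rewrite b6; lra.
Qed.

Lemma potential_init d A (T : 'M_d) m th xi : potential A T m th xi 0 [::] = 2 * d%:R.
Proof.
have U sg : @potential_mx d A T m%:R th xi sg 0 [::] = 1%:M.
  rewrite /potential_mx /gram_seq /gram_prefix big_nil big_ord0 /conj_mx mulmx0 mul0mx subrr.
  by rewrite !scaler0 subrr scaler0 addr0.
by rewrite /potential !U !expr1n mxtrace1; ring.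
Qed.

(** As [m] grows the power tends to [exp (th eps - xi)], and [th eps - xi = (14/25) (33/50) 3 L =
    1.1088 L], which leaves room above [21/20 L]. *)
Lemma potential_parameters (L c eps : R) : 0 < L -> 0 < c -> 0 < eps -> c * eps ^+ 2 = 3 * L ->
  let th := 33 / 50 * (c * eps) in let xi := 11 / 25 * (th * eps) in
  exists k, let m := (2 ^ k.+1)%N in
  th * eps + xi + (th / c + th + xi) <= m%:R / 100 /\
  exp (21 / 20 * L) <= (1 + (th * eps - xi) / m%:R) ^+ m.
Proof.
move=> L0 c0 e0 cL th xi.
pose z := th * eps - xi.
have zE : z = 6930 / 6250 * L.
  have -> : z = 14 / 25 * (33 / 50) * (c * eps ^+ 2) by rewrite /z /xi /th; field.
  by rewrite cL; field.
have th0 : 0 < th by rewrite /th; have := mulr_gt0 c0 e0; lra.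
have te0 : 0 < th * eps by rewrite mulr_gt0.
have xi0 : 0 < xi by rewrite /xi; lra.
have thc : 0 < th / c by rewrite divr_gt0.
have s0 : 0 <= th * eps + xi + (th / c + th + xi) by lra.
(* The first summands give the size of [m] asked for in the conclusion; the summand in [z] makes
   [z / m <= 1/100]. *)
pose X := 100 * (th * eps + xi + (th / c + th + xi) + `|z|).
have XE : X = 100 * (th * eps + xi + (th / c + th + xi) + `|z|) by [].
exists (Num.bound X) => m.
have Xm : X <= m%:R.
  apply: le_trans (ltW (archi_boundP _)) _.
    by have := normr_ge0 z; rewrite /X; lra.
  rewrite ler_nat /m; apply: leq_trans (ltnW (ltn_expl _ (isT : 1 < 2)%N)) _.
  by rewrite leq_exp2l.
have m0 : 0 < m%:R :> R by rewrite ltr0n expn_gt0.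
rewrite -/z; clearbody m X z; clearbody xi; clearbody th.
have z0 : 0 < z by rewrite zE; lra.
have zn : `|z| = z by rewrite gtr0_norm.
rewrite XE zn in Xm.
split; first by lra.
have zm : 0 <= z / m%:R by rewrite divr_ge0 ?ltW.
apply: le_trans (pow_ge_exp m zm).
have zm1 : z / m%:R <= 1 / 100 by rewrite ler_pdivrMr //; lra.
have -> : m%:R * (z / m%:R / (1 + z / m%:R)) = z / (1 + z / m%:R).
  by rewrite [in LHS]mulrA mulrCA mulfV ?mulr1 // gt_eqF.
have le1 : 21 / 20 * L <= z / (1 + z / m%:R).
  rewrite ler_pdivlMr; last by lra.
  set w := z / m%:R in zm1 zm *; rewrite zE.
  have : L * w <= L * (1 / 100) by rewrite ler_pM2l.
  lra.
exact: ler_exp.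
Qed.

(** * Number of rows *)

Lemma psd_addr_outer_ker (F : rcfType) d (M : 'M[F]_d) r (b z : 'cV_d) : M^T = M -> psd M -> 0 < r ->
  (M + r *: (b *m b^T)) *m z = 0 <-> M *m z = 0 /\ ip b z = 0.
Proof.
move=> sM pM r0; split=> [h|[h1 h2]]; last first.
  by rewrite mulmxDl h1 add0r -scalemxAl outer_mul h2 scale0r scaler0.
have : ip z ((M + r *: (b *m b^T)) *m z) = 0 by rewrite h ip0r.
rewrite mulmxDl ipDr -scalemxAl ipZr ip_outer (ipC z b) => /eqP.
have q0 : 0 <= r * (ip b z * ip b z) by apply: mulr_ge0; [exact: ltW | rewrite -expr2 sqr_ge0].
rewrite paddr_eq0 // => /andP[/eqP h1]; rewrite mulf_eq0 gt_eqF //= mulf_eq0 orbb => /eqP h2.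
by split=> //; apply: psd_ker h1.
Qed.

Lemma rows_combE d (A : mat) (c : nat -> R) (I : list nat) :
  (forall j, (j < d)%coq_nat -> fold_right Rplus 0 (List.map (fun i => Rmult (c i) (A i j)) I) = 0) <->
  \sum_(i <- I) c i *: cv d (Defs.row A i) = 0.
Proof.
have E j : fold_right Rplus 0 (List.map (fun i => Rmult (c i) (A i j)) I) =
    \sum_(i <- I) c i * A i j.
  by elim: I => [|i I IH] /=; rewrite ?big_nil // big_cons IH.
split=> [h|h j /ssrnat.ltP jd].
  apply/colP => j; rewrite summxE mxE.
  transitivity (\sum_(i <- I) c i * A i j); first by apply: eq_bigr => i _; rewrite !mxE.
  by rewrite -E h //; apply/ssrnat.ltP.
have := congr1 (fun M : 'cV[R]_d => M (Ordinal jd) 0) h.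
rewrite summxE mxE E => h0.
by rewrite -[RHS]h0; apply: eq_bigr => i _; rewrite !mxE.
Qed.

(** Pairing a vanishing combination with [x] kills every term except that of [i], so [c i = 0], and
    independence of [I] does the rest. *)
Lemma rows_indep_cons d A i I (x : 'cV_d) :
  ~ In i I -> rows_indep d A I ->
  (forall j, In j I -> ip (cv d (Defs.row A j)) x = 0) -> ip (cv d (Defs.row A i)) x != 0 ->
  rows_indep d A (i :: I).
Proof.
move=> iI indI xI xi c /rows_combE; rewrite big_cons => h.
have sumI : ip (\sum_(j <- I) c j *: cv d (Defs.row A j)) x = 0.
  elim: I xI {iI indI h} => [|j I IH] xI; first by rewrite big_nil ip0l.
  rewrite big_cons ipDl ipZl xI ?mulr0 ?add0r; last by left.
  by apply: IH => l lI; apply: xI; right.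
have ci : c i = 0.
  have := congr1 (ip^~ x) h; rewrite /= ipDl ipZl sumI addr0 ip0l => /eqP.
  by rewrite mulf_eq0 (negPf xi) orbF => /eqP.
move=> j [<- //|]; apply: indI; apply/rows_combE.
by rewrite ci scale0r add0r in h.
Qed.

Lemma rows_indep_tail d A i I : ~ In i I -> rows_indep d A (i :: I) -> rows_indep d A I.
Proof.
move=> iI ind c /rows_combE h j jI.
pose c' k := if k == i then 0 else c k.
have c'E k : In k I -> c' k = c k.
  by move=> kI; rewrite /c'; case: eqVneq => // ki; rewrite ki in kI.
rewrite -(c'E j jI); apply: (ind c'); last by right.
apply/rows_combE; rewrite big_cons {1}/c' eqxx scale0r add0r -[RHS]h.
elim: I c'E {iI ind h jI} => [|k I IH] c'E; first by rewrite !big_nil.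
rewrite !big_cons c'E; last by left.
by congr (_ + _); apply: IH => l lI; apply: c'E; right.
Qed.

(** [is_rank] excludes independent lists of length exactly [r + 1]; if the tail has length [r], the
    whole list would be one. *)
Lemma rank_bound_indep n d A r I : is_rank n d A r -> NoDup I ->
  List.Forall (fun i => (i < n)%coq_nat) I -> rows_indep d A I -> (List.length I <= r)%N.
Proof.
move=> [_ max]; elim: I => [//|i I IH] nd fI ind.
inversion nd; inversion fI; subst.
have := IH H2 H6 (rows_indep_tail H1 ind).
rewrite leq_eqVlt => /orP[/eqP e|//].
by case: (max (i :: I) nd _ fI ind); rewrite /= e.
Qed.

(** [I] lists the kept rows that enlarged the span. The inequality says [det (l + G_S) >= l^d (s2 /
    l)^q gam^(|S| - q)] for all small [l], multiplied out so that no quotient or truncated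
    subtraction occurs; the range [l0] may shrink with every row. Equality of the kernels persists
    because a row that enlarges the span has leverage score 1 and is always kept. *)
Definition row_count_inv d A (s2 gam : R) i (S : list vec) : Prop :=
  (forall z : 'cV_d, gram_prefix d A i *m z = 0 <-> gram_seq d S *m z = 0) /\
  exists I : list nat, let q := List.length I in
    [/\ NoDup I, List.Forall (fun j => (j < i)%coq_nat) I, rows_indep d A I,
        (\rank (gram_seq d S) <= q)%N &
        exists l0 : R, 0 < l0 /\ forall l, 0 < l < l0 ->
          l ^+ d * s2 ^+ q * gam ^+ List.length S <=
          \det (l%:M + gram_seq d S) * l ^+ q * gam ^+ q].

Lemma row_count_init d A s2 gam : row_count_inv d A s2 gam 0 [::].
Proof.
have G0 : gram_seq d [::] = 0 by rewrite /gram_seq big_nil.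
split=> [z|]; first by rewrite G0 /gram_prefix big_ord0.
exists [::]; split=> //=; first exact: NoDup_nil.
- by rewrite G0 mxrank0.
- by exists 1; split=> // l _; rewrite G0 addr0 det_scalar !expr0.
Qed.

(** Let [t] be the leverage score. If [t < 1], the row lies in the range of [G_S], so the span stays
    and keeping the row multiplies the determinant by at least [gam]. If [t = 1], then [x] is in the
    kernel of [G_S] but not orthogonal to the row, which joins [I]. *)
Lemma row_count_step d A (eps s2 : R) n i S :
  let c := c_param d eps in let gam := 1 + 2 / (3 * c) in
  let p := samp_prob d eps S (Defs.row A i) in
  1 <= c -> 0 < eps <= 1 / 2 -> 0 < s2 -> (i < n)%N ->
  (forall j (x : 'cV_d), (j <= n)%N -> (forall z, gram_prefix d A j *m z = 0 -> ip x z = 0) ->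
    s2 * ip x x <= ip x (gram_prefix d A j *m x)) ->
  row_count_inv d A s2 gam i S ->
  (0 < p -> row_count_inv d A s2 gam i.+1 (keep_row d eps A i S)) /\
  (p < 1 -> row_count_inv d A s2 gam i.+1 S).
Proof.
move=> c gam p c1 /andP[e0 e2] s20 i_n lb [ker [I [nd fI ind rk [l0 [l00 Hl]]]]].
set q := List.length I in rk Hl.
have c0 : 0 < c by lra.
have gam1 : 1 < gam by rewrite /gam ltrDl divr_gt0 // mulr_gt0.
pose a := Defs.row A i; pose b := cv d a; pose GS := gram_seq d S; pose t := lev_score d S a.
have [x [Mx bx xM]] := lev_scoreP d S a; rewrite -/b -/GS -/t in Mx bx xM.
have GSx : GS *m x = (1 - t) *: b.
  by rewrite scalerBl scale1r -{1}Mx mulmxDl outer_mul bx addrK.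
have /andP[t0 t1] := lev_score_range d S a; rewrite -/t in t0 t1.
(* Here [c >= 1] enters: a row of score 1 is never dropped. *)
have pt : t = 1 -> p = 1.
  move=> te; rewrite /p samp_probE -/a -/t te mulr1 -/c.
  have -> : Num.min (1 + eps) 1 = 1 :> R by rewrite min_r // lerDl ltW.
  by rewrite mulr1 min_r.
have sGS := gram_seq_sym d S; have pGS := @gram_seq_psd d S; rewrite -/GS in sGS pGS.
have kerS r (z : 'cV_d) : 0 < r -> (gram_prefix d A i.+1 *m z = 0 <-> (GS + r *: (b *m b^T)) *m z = 0).
  move=> r0; rewrite gram_prefixS.
  have h1 := psd_addr_outer_ker b z (gram_prefix_sym d A i) (@gram_prefix_psd d A i) ltr01.
  have h2 := psd_addr_outer_ker b z sGS pGS r0; rewrite scale1r in h1.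
  by split=> [/h1[/ker ? ?]|/h2[? ?]]; [apply/h2 | apply/h1]; split=> //; apply/ker.
have bGS : t < 1 -> b = (1 - t)^-1 *: (GS *m x).
  by move=> t1'; rewrite GSx scalerA mulVf ?scale1r // gt_eqF // subr_gt0.
have bker z : t < 1 -> GS *m z = 0 -> ip b z = 0.
  by move=> t1' h; rewrite bGS // ipZl ip_mull sGS h ip0r mulr0.
have fI' : List.Forall (fun j => (j < i.+1)%coq_nat) I.
  by apply: Forall_impl fI => j; apply: PeanoNat.Nat.lt_lt_succ_r.
split=> [p0|p1]; last first.
  have t1' : t < 1 by rewrite lt_neqAle t1 andbT; apply/eqP => /pt pe; move: p1; rewrite pe ltxx.
  split=> [z|].
    have h2 := psd_addr_outer_ker b z sGS pGS ltr01.
    split=> [/(kerS 1 z ltr01)/h2[]//|h]; apply/(kerS 1 z ltr01)/h2; split=> //.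
    exact: bker.
  by exists I; split=> //; exists l0.
rewrite /row_count_inv (gram_seq_keep p0) -/b -/a -/p -/GS.
have pV : 0 < p^-1 by rewrite invr_gt0.
have len : List.length (keep_row d eps A i S) = (List.length S).+1.
  by rewrite /keep_row List.length_app /= PeanoNat.Nat.add_1_r.
split=> [z|]; first exact: kerS.
have tpos : 0 < t.
  rewrite lt_def t0 andbT; apply/eqP => te; move: p0; rewrite /p samp_probE -/a -/t te mulr0.
  have E : Num.min (0 : R) 1 = 0 by rewrite min_l // ler01.
  by rewrite E mulr0 E ltxx.
have x0 : x != 0 by apply/eqP => xe; move: tpos; rewrite -bx xe ip0r ltxx.
have xx0 : 0 < ip x x by rewrite ip_gt0.
have xGx : ip x (GS *m x) = t - t ^+ 2.
  by rewrite GSx ipZr ipC bx; ring.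
(* [det_rank1_update_ge] with the test vector [x], for which [r = x^T (l + G_S) x]. *)
have detl l : 0 < l -> let r := l * ip x x + (t - t ^+ 2) in
    [/\ 0 < r, 0 < \det (l%:M + GS) &
     \det (l%:M + GS) * (r + t ^+ 2 / p) <= \det (l%:M + (GS + p^-1 *: (b *m b^T))) * r].
  move=> l0' r; pose M := l%:M + GS.
  have sM : M^T = M by rewrite linearD /= tr_scalar_mx sGS.
  have Mq y : ip y (M *m y) = l * ip y y + ip y (GS *m y).
    by rewrite mulmxDl mul_scalar_mx ipDr ipZr.
  have pM (y : 'cV_d) : y != 0 -> 0 < ip y (M *m y).
    move=> y0; rewrite Mq; apply: ltr_wpDr; first exact: pGS.
    by rewrite mulr_gt0 // ip_gt0.
  have rE : r = ip x (M *m x) by rewrite Mq xGx.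
  have := det_rank1_update_ge ((Num.sqrt p)^-1 *: b) x sM pM.
  rewrite ipZl bx exprMn exprVn sqr_sqrtr ?(ltW p0) // linearZ /= -scalemxAl -scalemxAr scalerA.
  rewrite -invfM -expr2 sqr_sqrtr ?(ltW p0) // -rE addrA (mulrC p^-1) => h.
  by split=> //; [rewrite rE; apply: pM | apply: det_posdef_gt0].
have [t1'|te] := ltrP t 1.
  exists I; rewrite -/q len; split=> //.
    apply: leq_trans rk; have -> : GS + p^-1 *: (b *m b^T) =
        GS *m (1%:M + (p^-1 * (1 - t)^-1) *: (x *m b^T)).
      rewrite mulmxDr mulmx1 {1}bGS // -!scalemxAl -scalemxAr scalerA.
      by rewrite mulmxA.
    exact: mxrankM_maxl.
  (* For [l] below this bound [r <= t], so the gain [t^2 / (p r)] is at least [t / p >= 2 / (3 c)],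
     by [p <= c (1 + eps) t <= 3/2 c t]. *)
  have l10 : 0 < t ^+ 2 / ip x x by rewrite divr_gt0 // exprn_gt0.
  exists (Num.min l0 (t ^+ 2 / ip x x)); rewrite lt_min l00 l10; split=> // l.
  rewrite lt_min => /andP[lp /andP[ll0 ll1]].
  have [r0 d0 hd] := detl l lp.
  have gd : gam * \det (l%:M + GS) <= \det (l%:M + (GS + p^-1 *: (b *m b^T))).
    rewrite -(ler_pM2r r0); apply: le_trans hd; rewrite mulrC mulrA [leLHS]mulrC.
    rewrite ler_pM2l // /gam mulrDr mulr1 lerD2l.
    rewrite ltr_pdivlMr // in ll1.
    apply: le_trans (_ : t * (2 / (3 * c)) <= _).
      apply: ler_wpM2r; last lra.
      by rewrite divr_ge0 // mulr_ge0 // ltW.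
    have pc : p <= 3 / 2 * c * t.
      rewrite /p samp_probE ge_min; apply/orP; left; rewrite -/c -/a -/t.
      apply: le_trans (_ : c * (3 / 2 * t) <= _); last by rewrite mulrA (mulrC c).
      rewrite ler_pM2l // ge_min; apply/orP; left; rewrite ler_pM2r //; lra.
    have v0 : 0 <= 2 / (3 * c) by rewrite divr_ge0 // mulr_ge0 // ltW.
    rewrite ler_pdivlMr // mulrAC (mulrC t p).
    apply: le_trans (_ : 3 / 2 * c * t * t * (2 / (3 * c)) <= _).
      by apply: ler_wpM2r => //; rewrite ler_pM2r.
    rewrite le_eqVlt; apply/orP; left; apply/eqP; field; exact: lt0r_neq0.
  have lq : 0 < l ^+ q * gam ^+ q by rewrite mulr_gt0 // exprn_gt0 //; lra.
  have gam0 : 0 < gam by lra.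
  rewrite (exprS gam (List.length S)) mulrCA.
  apply: le_trans (_ : gam * (\det (l%:M + GS) * l ^+ q * gam ^+ q) <= _).
    by rewrite ler_pM2l // Hl // lp ll0.
  rewrite -!mulrA [leLHS]mulrA ler_pM2r //.
have {}te : t = 1 by apply/eqP; rewrite eq_le t1 te.
have GSx0 : GS *m x = 0 by rewrite GSx te subrr scale0r.
have Gix0 : gram_prefix d A i *m x = 0 by apply/ker.
have iI : ~ In i I.
  by move=> /(proj1 (Forall_forall _ _) fI); apply: PeanoNat.Nat.lt_irrefl.
exists (i :: I); rewrite /= -/q len; split.
- exact: NoDup_cons.
- by apply: Forall_cons => //; apply: PeanoNat.Nat.lt_succ_diag_r.
- apply: (@rows_indep_cons d A i I x) => //; last by rewrite -/a -/b bx te oner_eq0.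
  move=> j /(proj1 (Forall_forall _ _) fI) ji; apply: gram_prefix_ker Gix0.
  exact/ssrnat.ltP.
- apply: leq_trans (mxrank_add _ _) _; rewrite -[q.+1]addn1; apply: leq_add => //.
  by apply: leq_trans (mxrank_scale _ _) _; apply: leq_trans (mxrankM_maxl _ _) (rank_leq_col _).
- exists l0; split=> // l /andP[lp ll0]; have [r0 d0 hd] := detl l lp.
  have pe := pt te; rewrite te pe expr1n subrr addr0 divr1 in r0 hd.
  (* [x] is orthogonal to all earlier rows and has product 1 with the new one, so the lower bound on
     the form gives [s2 |x|^2 <= 1], and the determinant grows by at least
     [1 / (l |x|^2) >= s2 / l]. *)
  have Gx1 : ip x (gram_prefix d A i.+1 *m x) = 1.
    by rewrite gram_prefixS mulmxDl Gix0 add0r outer_mul -/a -/b ipZr (ipC x b) bx te mulr1.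
  have sx : s2 * ip x x <= 1.
    rewrite -Gx1; apply: lb => // z /(kerS 1 z ltr01); rewrite scale1r; exact: xM.
  rewrite pe invr1 in hd *.
  set D := \det (l%:M + GS) in d0 hd; set D' := \det _ in hd *.
  have D'0 : 0 < D'.
    rewrite -(pmulr_lgt0 _ r0); apply: lt_le_trans hd.
    by rewrite mulr_gt0 // addr_gt0.
  have sD : s2 * D <= D' * l.
    have : D <= D' * (l * ip x x) by apply: le_trans hd; rewrite -{1}[D]mulr1 ler_pM2l // lerDr ltW.
    rewrite -(ler_pM2l s20) => h; apply: le_trans h _.
    have -> : s2 * (D' * (l * ip x x)) = D' * l * (s2 * ip x x) by ring.
    by rewrite -[leRHS]mulr1 ler_pM2l // mulr_gt0.
  have := Hl l; rewrite lp ll0 => /(_ isT); rewrite -/GS -/D => h.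
  have gam0 : 0 < gam by lra.
  have -> : l ^+ d * s2 ^+ q.+1 * gam ^+ (List.length S).+1 =
    (s2 * gam) * (l ^+ d * s2 ^+ q * gam ^+ List.length S) by rewrite !exprS; ring.
  apply: le_trans (_ : s2 * gam * (D * l ^+ q * gam ^+ q) <= _).
    by rewrite ler_pM2l // mulr_gt0.
  have -> : s2 * gam * (D * l ^+ q * gam ^+ q) = s2 * D * (gam * l ^+ q * gam ^+ q) by ring.
  have -> : D' * l ^+ q.+1 * gam ^+ q.+1 = D' * l * (gam * l ^+ q * gam ^+ q).
    by rewrite !exprS; ring.
  by rewrite ler_pM2r // !mulr_gt0 // exprn_gt0.
Qed.

(** * Extreme singular values *)

(** [s] is the square root of the least nonzero entry of the spectral diagonal [D]; orthogonally to
    the kernel only the coordinates with [D 0 l != 0] contribute to the form. *)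
Lemma psd_least_eigenvalue (F : rcfType) d (G : 'M[F]_d) : G^T = G -> psd G -> G != 0 ->
  exists s : F, [/\ 0 < s, exists x : 'cV_d, x != 0 /\ G *m x = s ^+ 2 *: x,
    forall s' (x : 'cV_d), 0 <= s' -> s' != 0 -> x != 0 -> G *m x = s' ^+ 2 *: x -> s <= s' &
    forall x : 'cV_d, (forall z : 'cV_d, G *m z = 0 -> ip x z = 0) ->
      s ^+ 2 * ip x x <= ip x (G *m x)].
Proof.
move=> sG pG G0; have [V [D [VV GE]]] := sym_spectral sG.
have D0 k : 0 <= D 0 k.
  by apply: (spectral_lb (V := V)) => // x; rewrite mul0r -GE.
have [k0 k0P] : exists k, D 0 k != 0.
  apply/existsP; apply: contraR G0 => /existsPn h; rewrite GE.
  have -> : diag_mx D = 0; last by rewrite mulmx0 mul0mx.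
  apply/matrixP => i j; rewrite !mxE; have /negPn/eqP -> := h i.
  by rewrite mul0rn.
case: (@arg_minP _ _ _ k0 (fun k => D 0 k != 0) (fun k => D 0 k) k0P) => k kP kmin.
exists (Num.sqrt (D 0 k)); have sE : Num.sqrt (D 0 k) ^+ 2 = D 0 k by rewrite sqr_sqrtr.
split; rewrite ?sE.
- by rewrite sqrtr_gt0 lt_def kP D0.
- exists (V^T *m delta_mx k 0); split; last by rewrite GE spectral_eigenvalue.
  by rewrite -ip_eq0 spectral_vec_norm // oner_eq0.
- move=> s' x s'0 s'n x0 Gx.
  have [l lP] : exists l, (V *m x) l 0 != 0.
    apply/existsP; apply: contraR x0 => /existsPn h.
    rewrite -ip_eq0 -(spectral_norm x VV) big1 // => l _.
    by have /negPn/eqP -> := h l; rewrite expr0n.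
  have : D 0 l * (V *m x) l 0 = s' ^+ 2 * (V *m x) l 0.
    rewrite -mul_diag_col -[X in X *m (V *m x)]mul1mx -(spectral_mulmxV VV).
    rewrite -!mulmxA [V^T *m _]mulmxA [_ *m (V *m x)]mulmxA -GE Gx -scalemxAr.
    by rewrite mxE.
  move/(mulIf lP) => Dl; rewrite -(ler_pXn2r (n := 2)) ?nnegrE ?sqrtr_ge0 // sE -Dl.
  by apply: kmin; rewrite Dl expf_neq0.
- move=> x xker; rewrite -(spectral_norm x VV) [in leRHS]GE spectral_quad mulr_sumr.
  apply: ler_sum => l _; have [Dl|Dl] := eqVneq (D 0 l) 0.
    rewrite -ip_spectral_vec xker ?expr0n ?mulr0 //.
    by rewrite GE spectral_eigenvalue // Dl scale0r.
  by apply: ler_wpM2r; [exact: sqr_ge0 | exact: kmin].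
Qed.

Lemma sym_quad_bounded (F : rcfType) d (G : 'M[F]_d) : G^T = G ->
  exists C : F, 0 <= C /\ forall x : 'cV_d, ip x (G *m x) <= C * ip x x.
Proof.
move=> sG; have [V [D [VV GE]]] := sym_spectral sG.
exists (\sum_k `|D 0 k|); split; first by apply: sumr_ge0 => k _; rewrite normr_ge0.
move=> x; rewrite GE spectral_quad -(spectral_norm x VV) mulr_sumr.
apply: ler_sum => k _; apply: ler_wpM2r; first exact: sqr_ge0.
apply: le_trans (ler_norm _) _; rewrite (bigD1 k) //= lerDl.
by apply: sumr_ge0 => l _; rewrite normr_ge0.
Qed.

Lemma is_eigenvalueE k d A l : is_eigenvalue d (gram k A) l <->
  exists x : 'cV[R]_d, x != 0 /\ gram_prefix d A k *m x = l *: x.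
Proof.
split=> [[x [[j [/ssrnat.ltP jd xj]] h]]|[x [x0 h]]].
  exists (cv d x); split.
    apply/eqP => /(congr1 (fun M : 'cV[R]_d => M (Ordinal jd) 0)).
    by rewrite !mxE.
  rewrite -gramE -mat_applyE; apply/colP => i; rewrite !mxE; apply: h.
  exact/ssrnat.ltP.
exists (vec_of x); split.
  have /existsP[i xi] : [exists i, x i 0 != 0].
    apply: contraR x0 => /existsPn h'; apply/eqP/colP => i; rewrite mxE.
    by have /negPn/eqP := h' i.
  exists i; split; first exact/ssrnat.ltP.
  by have := vec_ofK x => /colP/(_ i); rewrite mxE => ->; apply/eqP.
move=> j /ssrnat.ltP jd.
have := congr1 (fun M : 'cV[R]_d => M (Ordinal jd) 0) h.
rewrite -{1}(vec_ofK x) -gramE -mat_applyE !mxE => ->.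
by have := vec_ofK x => /colP/(_ (Ordinal jd)); rewrite mxE => <-.
Qed.

Lemma prefix_nonzeroE i d A : prefix_nonzero i d A <-> gram_prefix d A i != 0.
Proof.
split=> [[j [k [/ssrnat.ltP ji [/ssrnat.ltP kd Ajk]]]]|G0].
  apply/eqP => G0; apply: Ajk.
  have := @gram_prefix_ker d A i j (delta_mx (Ordinal kd) 0) ji.
  by rewrite G0 mul0mx ip_delta mxE; apply.
apply: NNPP => h; move/eqP: G0; apply; rewrite /gram_prefix big1 // => j _.
have -> : cv d (Defs.row A j) = 0; last by rewrite mul0mx.
apply/colP => k; rewrite !mxE; apply: NNPP => Ajk; apply: h.
by exists j, k; split; [|split=> //]; apply/ssrnat.ltP.
Qed.

(** A least nonzero singular value exists and is unique, so the value chosen by [epsilon] is the one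
    from [psd_least_eigenvalue]. *)
Lemma sigma_minP i d A : prefix_nonzero i d A -> let s := sigma_min i d A in
  [/\ 0 < s, exists x : 'cV_d, x != 0 /\ gram_prefix d A i *m x = s ^+ 2 *: x &
    forall x : 'cV_d, (forall z : 'cV_d, gram_prefix d A i *m z = 0 -> ip x z = 0) ->
      s ^+ 2 * ip x x <= ip x (gram_prefix d A i *m x)].
Proof.
move=> /prefix_nonzeroE G0.
have [s0 [s0p ev s0min lb]] :=
  psd_least_eigenvalue (gram_prefix_sym d A i) (@gram_prefix_psd d A i) G0.
have sv s : is_singular_value i d A s <-> 0 <= s /\
    exists x : 'cV[R]_d, x != 0 /\ gram_prefix d A i *m x = s ^+ 2 *: x.
  rewrite /is_singular_value -is_eigenvalueE RpowE.
  by split=> -[/RleP ? ?]; split=> //; apply/RleP.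
pose P s := is_singular_value i d A s /\ s <> 0 /\
     (forall s', is_singular_value i d A s' -> s' <> 0 -> Rle s s').
have Ps0 : P s0.
  split; first by apply/sv; split=> //; apply: ltW.
  split; first by apply/eqP; rewrite gt_eqF.
  by move=> s' /sv[s'0 [x [x0 Gx]]] /eqP s'n; apply/RleP; apply: s0min Gx.
have [sv1 [sn smin]] : P (sigma_min i d A).
  exact (epsilon_spec Defs.inhR P (ex_intro _ s0 Ps0)).
suff -> : sigma_min i d A = s0 by split.
apply: le_anti; apply/andP; split; first by apply/RleP/smin; case: Ps0 => ? [].
by move/sv: sv1 => [s1 [x [x0 Gx]]]; apply: s0min Gx => //; apply/eqP.
Qed.

Lemma exists_min (P : nat -> Prop) (f : nat -> R) n : (exists i, (i <= n)%N /\ P i) ->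
  exists i, [/\ (i <= n)%N, P i & forall j, (j <= n)%N -> P j -> f i <= f j].
Proof.
elim: n => [|n IH] [i [i_n Pi]].
  exists i; split=> // j; move: i_n; rewrite leqn0 => /eqP -> .
  by rewrite leqn0 => /eqP -> _.
have [h|h] := classic (exists i, (i <= n)%N /\ P i); last first.
  have only j : (j <= n.+1)%N -> P j -> j = n.+1.
    rewrite leq_eqVlt => /orP[/eqP //|jn] Pj; case: h; by exists j.
  by exists i; split=> // j jn Pj; rewrite (only _ i_n Pi) (only _ jn Pj).
have [k [kn Pk kmin]] := IH h.
have [[Pn fn]|hn] := classic (P n.+1 /\ f n.+1 < f k).
  exists n.+1; split=> // j; rewrite leq_eqVlt => /orP[/eqP -> //|jn] Pj.
  by apply: le_trans (ltW fn) _; apply: kmin.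
exists k; split=> //; first exact: leqW.
move=> j; rewrite leq_eqVlt => /orP[/eqP -> |jn] Pj; last exact: kmin.
by rewrite leNgt; apply/negP => fn; apply: hn.
Qed.

(** The set in the definition of [opnorm] is nonempty and bounded, so completeness provides a
    supremum and [epsilon] returns it; scaling [x] to norm 1 gives the bound. *)
Lemma opnorm_quad_le n d A (x : 'cV_d) :
  ip x (gram_prefix d A n *m x) <= opnorm n d A ^+ 2 * ip x x.
Proof.
have [->|x0] := eqVneq x 0; first by rewrite !ip0l mulr0.
have [C [C0 HC]] := sym_quad_bounded (gram_prefix_sym d A n).
have normE y : vnorm n (mat_apply d A y) =
    Num.sqrt (ip (cv d y) (gram_prefix d A n *m cv d y)).
  rewrite /vnorm RsqrtE quad_sum_outer dotE; congr Num.sqrt.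
  apply: eq_bigr => i _; rewrite -expr2 mat_applyE !mxE; congr (_ ^+ 2).
  by apply: eq_bigr => j _; rewrite !mxE.
pose E y := exists x : vec, vnorm d x = 1 /\ y = vnorm n (mat_apply d A x).
have xx0 : 0 < ip x x by rewrite ip_gt0.
have [s [s0 ss]] : exists s, s != 0 /\ s ^+ 2 = ip x x.
  by exists (Num.sqrt (ip x x)); rewrite sqr_sqrtr ?ltW // sqrtr_eq0 -ltNge.
pose w := s^-1 *: x.
have ww : ip w w = 1 by rewrite /w ipZl ipZr -ss; field.
have Ew : E (Num.sqrt (ip w (gram_prefix d A n *m w))).
  exists (vec_of w); rewrite normE vec_ofK; split=> //.
  by rewrite /vnorm RsqrtE dotE vec_ofK ww sqrtr1.
have lub : is_lub E (opnorm n d A).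
  apply: (epsilon_spec Defs.inhR (is_lub E)).
  have [||m] := completeness E; [|by eexists; exact: Ew|by move=> mP; exists m].
  (* [1 + C] bounds every [r] with [r^2 <= C]. *)
  exists (1 + C) => y [v [v1 ->]]; rewrite normE; apply/RleP.
  have vv : ip (cv d v) (cv d v) = 1.
    move: v1; rewrite /vnorm RsqrtE dotE => /(congr1 (fun t => t ^+ 2)).
    by rewrite sqr_sqrtr ?ip_ge0 // expr1n.
  have := HC (cv d v); rewrite vv mulr1.
  set q := ip _ _; have q0 : 0 <= q := @gram_prefix_psd d A n (cv d v).
  have := sqr_sqrtr q0; have := sqrtr_ge0 q; set r := Num.sqrt q; move=> r0 rq qC.
  nra.
have /RleP le1 := proj1 lub _ Ew.
have q0 : 0 <= ip w (gram_prefix d A n *m w) := @gram_prefix_psd d A n w.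
have le2 : ip w (gram_prefix d A n *m w) <= opnorm n d A ^+ 2.
  rewrite -(sqr_sqrtr q0) lerXn2r ?nnegrE ?sqrtr_ge0 //.
  exact: le_trans (sqrtr_ge0 _) le1.
rewrite -ler_pdivrMr //; apply: le_trans le2.
rewrite /w -scalemxAr ipZl ipZr le_eqVlt; apply/orP; left; apply/eqP.
by rewrite -ss; field.
Qed.

(** The minimum over the prefixes is attained, so [epsilon] returns it; an eigenvector of the
    attaining prefix shows [m <= |A|^2]. For a zero prefix the last claim concerns [x = 0] only. *)
Lemma min_prefix_sigma2P n d A : prefix_nonzero n d A ->
  let m := min_prefix_sigma2 n d A in
  [/\ 0 < m, m <= opnorm n d A ^+ 2 &
    forall j (x : 'cV_d), (j <= n)%N ->
      (forall z : 'cV_d, gram_prefix d A j *m z = 0 -> ip x z = 0) ->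
      m * ip x x <= ip x (gram_prefix d A j *m x)].
Proof.
move=> An m.
pose f i := sigma_min i d A ^+ 2.
have [i0 [i0n P0 min0]] := @exists_min (fun i => prefix_nonzero i d A) f n
  (ex_intro _ n (conj (leqnn n) An)).
have i0_gt0 i : prefix_nonzero i d A -> (0 < i)%N.
  by case: i => // -[j [k [/ssrnat.ltP]]].
pose P m :=
    (exists i, (Peano.le 1 i /\ Peano.le i n) /\ prefix_nonzero i d A /\ m = pow (sigma_min i d A) 2) /\
    (forall i, (Peano.le 1 i /\ Peano.le i n) -> prefix_nonzero i d A -> Rle m (pow (sigma_min i d A) 2)).
have [[i [[_ /ssrnat.leP i_n] [Pi mE]]] mle] : P m.
  apply: (epsilon_spec Defs.inhR P); exists (f i0); split.
    exists i0; split; first by split; apply/ssrnat.leP => //; apply: i0_gt0.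
    by split=> //; rewrite RpowE.
  move=> i [_ /ssrnat.leP i_n] Pi; rewrite RpowE; apply/RleP; exact: min0.
rewrite RpowE in mE; have [sp [x [x0 Gx]] _] := sigma_minP Pi.
split.
- by rewrite mE exprn_gt0.
- have xx0 : 0 < ip x x by rewrite ip_gt0.
  rewrite -(ler_pM2r xx0); apply: le_trans (opnorm_quad_le n A x).
  by apply: le_trans (gram_prefix_quad_le A x i_n); rewrite Gx ipZr mE.
- move=> j y jn yker; have [Pj|nPj] := classic (prefix_nonzero j d A); last first.
    have G0 : gram_prefix d A j = 0.
      by apply/eqP; apply/negPn/negP => /prefix_nonzeroE.
    have /eqP -> : ip y y == 0 by rewrite yker // G0 mul0mx.
    by rewrite mulr0 G0 mul0mx ip0r.
  have [_ _ lbj] := sigma_minP Pj; apply: le_trans (lbj y yker).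
  apply: ler_wpM2r; first exact: ip_ge0.
  have := mle j _ Pj; rewrite RpowE => h; apply/RleP/h; split; apply/ssrnat.leP => //.
  exact: i0_gt0.
Qed.

(** * The theorem *)

Lemma ler_exp_inv (x y : R) : exp x <= exp y -> x <= y.
Proof. by rewrite !leNgt; apply: contra => /RltP/exp_increasing/RltP. Qed.

Lemma rows_indep_prefix_nonzero n d A I : NoDup I ->
  List.Forall (fun i => (i < n)%coq_nat) I -> rows_indep d A I -> (0 < List.length I)%N ->
  prefix_nonzero n d A.
Proof.
case: I => // i I nd fI ind _; apply: NNPP => hA.
have Ai j : (j < d)%N -> A i j = 0.
  move=> jd; apply: NNPP => Aij; apply: hA; inversion fI; subst.
  by exists i, j; split=> //; split=> //; apply/ssrnat.ltP.
have iI : ~ In i I by inversion nd.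
have := ind (fun j => if j == i then 1 else 0).
case/(_ _ i (or_introl erefl))/wrap; last by move/eqP; rewrite eqxx oner_eq0.
move=> j /ssrnat.ltP jd /=; rewrite eqxx Ai // RplusE RmultE mulr0 add0r.
elim: I iI {nd fI ind} => //= k I IH iI; rewrite IH; last by move=> h; apply: iI; right.
have /negPf -> : k != i by apply/eqP => ki; apply: iI; left.
by rewrite RmultE mul0r RplusE addr0.
Qed.

Lemma exp_lnK (x : R) : 0 < x -> exp (ln x) = x.
Proof. by move=> /RltP; apply: exp_ln. Qed.

(** The invariant bounds [det (l + G_S)] from below and [det_shift_le] from above; the powers of [l]
    cancel and leave [gam^(|S| - q) <= X^q] with [X = 2 b / s2]. For the logarithms, [pow_ge_exp]
    supplies [1 / (3/2 c + 1)] as a lower bound for [ln gam]. *)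
Lemma row_count_bound d A (s2 b c : R) n S r : let gam := 1 + 2 / (3 * c) in
  is_rank n d A r -> 0 < c -> 0 < s2 -> 0 <= b ->
  (prefix_nonzero n d A -> s2 <= b) ->
  row_count_inv d A s2 gam n S ->
  (forall x : 'cV_d, ip x (gram_seq d S *m x) <= 3 / 2 * b * ip x x) ->
  exists q, [/\ (q <= r)%N, (0 < q)%N -> prefix_nonzero n d A &
    (List.length S)%:R <= q%:R + q%:R * (3 / 2 * c + 1) * ln (2 * (b / s2))].
Proof.
move=> gam rk c0 s20 b0 sb [_ [I [nd fI ind rkS [l0 [l00 Hl]]]]] Sb.
set q := List.length I in rkS Hl; exists q.
have gam1 : 1 < gam by rewrite /gam ltrDl divr_gt0 // mulr_gt0.
have gam0 : 0 < gam by lra.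
have qA : (0 < q)%N -> prefix_nonzero n d A by apply: rows_indep_prefix_nonzero.
split=> //; first exact: rank_bound_indep rk nd fI ind.
(* Half of [l0] lies strictly inside the allowed range, and for [q > 0] the bound
   [l <= s2 / 2 <= b / 2] gives [l + 3/2 b <= 2 b]. *)
pose l := Num.min (l0 / 2) (s2 / 2).
have lp : 0 < l by rewrite lt_min !divr_gt0.
have ll0 : l < l0 by rewrite gt_min; apply/orP; left; lra.
have ls : l <= s2 / 2 by rewrite ge_min lexx orbT.
have b32 : 0 <= 3 / 2 * b by lra.
have D := det_shift_le (gram_seq_sym d S) (@gram_seq_psd d S) Sb rkS lp b32.
have := Hl l; rewrite lp ll0 => /(_ isT) H.
have ld : 0 < l ^+ d by rewrite exprn_gt0.
pose X := 2 * (b / s2).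
have key : gam ^+ List.length S <= X ^+ q * gam ^+ q.
  have H1 : s2 ^+ q * gam ^+ List.length S <= (l + 3 / 2 * b) ^+ q * gam ^+ q.
    rewrite -(ler_pM2l ld) mulrA; apply: le_trans H _; rewrite mulrA.
    by rewrite ler_pM2r ?exprn_gt0.
  have H2 : (l + 3 / 2 * b) ^+ q <= (s2 * X) ^+ q.
    case: (posnP q) => [->|q0]; first by rewrite !expr0.
    have sb' := sb (qA q0).
    have XE : s2 * X = 2 * b by rewrite /X; field; rewrite gt_eqF.
    rewrite XE; apply: lerXn2r; rewrite ?nnegrE; lra.
  rewrite -(@ler_pM2l _ (s2 ^+ q)) ?exprn_gt0 //; apply: le_trans H1 _.
  apply: le_trans (_ : (s2 * X) ^+ q * gam ^+ q <= _); last by rewrite exprMn mulrA.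
  by rewrite ler_pM2r ?exprn_gt0.
have [Sq|qS] := leqP (List.length S) q.
  have lS : (List.length S)%:R <= q%:R :> R by rewrite ler_nat.
  apply: le_trans lS _; rewrite lerDl.
  case: (posnP q) => [->|q0]; first by rewrite !mul0r.
  have sb' := sb (qA q0).
  apply: mulr_ge0; first by apply: mulr_ge0; [exact: ler0n | lra].
  apply: ler_exp_inv; rewrite expR0.
  have X1 : 1 <= 2 * (b / s2).
    by have h : 1 <= b / s2; [rewrite ler_pdivlMr // mul1r | lra].
  rewrite exp_lnK //; lra.
(* With [q = 0] a nonempty sample would give [1 < gam^|S| <= 1]. *)
case: (posnP q) => [q0|q0].
  move: key; rewrite q0 !expr0 mulr1 => h; exfalso.
  have : 1 < gam ^+ List.length S by rewrite exprn_egt1 // -lt0n (leq_ltn_trans _ qS).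
  by rewrite ltNge h.
have sb' := sb (qA q0).
have X1 : 1 <= X by rewrite /X; have h : 1 <= b / s2; [rewrite ler_pdivlMr // mul1r | lra].
have X0 : 0 < X by lra.
have key2 : gam ^+ (List.length S - q) <= X ^+ q.
  by rewrite -(@ler_pM2r _ (gam ^+ q)) ?exprn_gt0 // -exprD subnK // ltnW.
pose y := 2 / (3 * c); have y0 : 0 < y by rewrite divr_gt0 // mulr_gt0.
have key3 : exp ((List.length S - q)%:R * (y / (1 + y))) <= exp (q%:R * ln X).
  apply: le_trans (pow_ge_exp _ (ltW y0)) _; apply: le_trans key2 _.
  by rewrite [q%:R * _]mulr_natl -expRX exp_lnK.
move/ler_exp_inv: key3; rewrite natrB ?(ltnW qS) //.
have -> : y / (1 + y) = (3 / 2 * c + 1)^-1.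
  by rewrite /y; field; rewrite !gt_eqF //; lra.
have k0 : 0 < 3 / 2 * c + 1 by lra.
rewrite ler_pdivrMr // -/X => h.
rewrite -mulrA [_ * ln X]mulrC mulrA; lra.
Qed.

(** Truncation at 1 plays the role of stopping: the one-step inequality is available only while
    [z < 1], and for [z >= 1] the bound by 1 is trivial. *)
Lemma min1_supermartingale (p x y z : R) : 0 <= p <= 1 ->
  (z < 1 -> p * x + (1 - p) * y <= z) ->
  p * Num.min 1 x + (1 - p) * Num.min 1 y <= Num.min 1 z.
Proof.
case/andP=> p0 p1 h.
have hx : Num.min 1 x <= 1 by rewrite ge_min lexx.
have hy : Num.min 1 y <= 1 by rewrite ge_min lexx.
have hx' : Num.min 1 x <= x by rewrite ge_min lexx orbT.
have hy' : Num.min 1 y <= y by rewrite ge_min lexx orbT.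
have q0 : 0 <= 1 - p by rewrite subr_ge0.
have a1 := ler_wpM2l p0 hx; have a2 := ler_wpM2l q0 hy.
have a3 := ler_wpM2l p0 hx'; have a4 := ler_wpM2l q0 hy'.
rewrite le_min; apply/andP; split; first lra.
have [z1|z1] := lerP 1 z; first lra.
have := h z1; lra.
Qed.

(** Markov's inequality: at the end [V] dominates the indicator of failure, whose expectation is
    thus at most the initial value. *)
Lemma alg_prob_ge d eps A n (E : list vec -> Prop) (Inv : nat -> list vec -> Prop) V v :
  (forall S, Inv n S -> ~ E S -> 1 <= V n S) -> (forall S, 0 <= V n S) ->
  (forall i S, (i < n)%N -> Inv i S -> let p := samp_prob d eps S (Defs.row A i) in
    [/\ 0 <= p <= 1, 0 < p -> Inv i.+1 (keep_row d eps A i S), p < 1 -> Inv i.+1 S &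
      p * V i.+1 (keep_row d eps A i S) + (1 - p) * V i.+1 S <= V i S]) ->
  Inv 0%N [::] -> V 0%N [::] <= v -> 1 - v <= alg_prob n d A eps E.
Proof.
move=> VE V0 step I0 Vv.
have -> : alg_prob n d A eps E = alg_expect d eps A n 0 [::] (fun L => indicator (E L)) by [].
rewrite lerBlDl -lerBlDr -alg_expect_compl; apply: le_trans Vv.
apply: (alg_expect_le (n := n) (Inv := Inv)) => //; last by rewrite addn0.
move=> S IS; rewrite /indicator; case: excluded_middle_informative => h.
  by rewrite subrr.
by rewrite subr0 VE.
Qed.

Lemma approx_of_quad n d A S eps :
  (forall (sg : R) (x : 'cV_d), sg = 1 \/ sg = -1 ->
    sg * (ip x (gram_seq d S *m x) - ip x (gram_prefix d A n *m x)) <=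
      eps * ip x (gram_prefix d A n *m x)) -> spectral_approx n d A S eps.
Proof.
have scE c M x : quad d (mscale c M) x = c * quad d M x.
  rewrite !quadE; have -> : mx_of d d (mscale c M) = c *: mx_of d d M.
    by apply/matrixP => i j; rewrite !mxE.
  by rewrite -scalemxAl ipZr.
move=> h; split=> x; apply/RleP; rewrite scE !quadE gramLE gramE ?RminusE ?RplusE ?R1E.
  by have := h (-1) (cv d x) (or_intror erefl); lra.
by have := h 1 (cv d x) (or_introl erefl); lra.
Qed.

Lemma approx_quad n d A S eps : spectral_approx n d A S eps ->
  forall x : 'cV_d, ip x (gram_seq d S *m x) <= (1 + eps) * ip x (gram_prefix d A n *m x).
Proof.
case=> _ h x; have /RleP := h (vec_of x); rewrite !quadE gramLE vec_ofK.
have -> : mx_of d d (mscale (Rplus 1 eps) (gram n A)) = (1 + eps) *: gram_prefix d A n.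
  by rewrite -gramE; apply/matrixP => i j; rewrite !mxE.
by rewrite -scalemxAl ipZr.
Qed.

(** For [A = 0] the values chosen by [epsilon] in [mu] are unspecified; [s2 = 1] then serves, as the
    last clause concerns [x = 0] only. *)
Lemma spectrum_bounds n d A : exists s2 b : R,
  [/\ 0 < s2, 0 <= b, prefix_nonzero n d A -> s2 <= b /\ mu n d A = b / s2,
    forall x : 'cV_d, ip x (gram_prefix d A n *m x) <= b * ip x x &
    forall j (x : 'cV_d), (j <= n)%N ->
      (forall z : 'cV_d, gram_prefix d A j *m z = 0 -> ip x z = 0) ->
      s2 * ip x x <= ip x (gram_prefix d A j *m x)].
Proof.
have [Pn|nPn] := classic (prefix_nonzero n d A).
  have [m0 mb lb] := min_prefix_sigma2P Pn.
  exists (min_prefix_sigma2 n d A), (opnorm n d A ^+ 2); split=> //.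
  - exact: sqr_ge0.
  - by move=> _; split=> //; rewrite /mu RdivE RpowE.
  - exact: opnorm_quad_le.
exists 1, (opnorm n d A ^+ 2); split=> //; [exact: sqr_ge0 | exact: opnorm_quad_le |].
have Gn : gram_prefix d A n = 0 by apply/eqP/negPn/negP => /prefix_nonzeroE.
move=> j x jn xker.
have Gj (z : 'cV_d) : gram_prefix d A j *m z = 0.
  by apply: gram_prefix_ker_mono jn _; rewrite Gn mul0mx.
by rewrite Gj ip0r xker ?mulr0.
Qed.

(** The constants come from [9/2 W + 1 <= 11/2 W], from [ln (2 M) <= 1 + ln M], which holds by
    [2 <= exp 1], and from [11/2 + 1 <= 7]. *)
Lemma row_count_le (q rho c W L M x : R) : c = 3 * W -> 1 <= W -> 0 <= L ->
  0 <= q <= rho -> 1 <= M -> x <= q + q * (3 / 2 * c + 1) * ln (2 * M) ->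
  x <= 7 * ((rho * ln M + rho + L) * W).
Proof.
move=> -> W1 L0 /andP[q0 qr] M1 xq; set l := ln M.
have M0 : 0 < M by lra.
have l0 : 0 <= l by apply: ler_exp_inv; rewrite expR0 exp_lnK.
have ln2 : ln (2 * M) <= 1 + l.
  apply: ler_exp_inv; rewrite exp_lnK; last lra.
  rewrite -expRD exp_lnK //.
  by rewrite ler_pM2r //; have := exp_ge1Dx 1; lra.
apply: le_trans xq _; clearbody l.
have a1 : q * (3 / 2 * (3 * W) + 1) * ln (2 * M) <= rho * (11 / 2 * W) * (1 + l).
  apply: le_trans (_ : q * (3 / 2 * (3 * W) + 1) * (1 + l) <= _).
    by apply: ler_wpM2l => //; apply: mulr_ge0 => //; lra.
  apply: ler_wpM2r; first lra.
  by apply: ler_pM => //; lra.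
have r0 : 0 <= rho by apply: le_trans qr.
have a3 : q <= rho * W.
  by apply: le_trans qr _; rewrite -[leLHS]mulr1; apply: ler_wpM2l.
have W0 : 0 <= W by lra.
have a4 := mulr_ge0 L0 W0; have a5 := mulr_ge0 r0 W0; have a6 := mulr_ge0 (mulr_ge0 r0 l0) W0.
have a7 : rho * (11 / 2 * W) * (1 + l) = 11 / 2 * (rho * W) + 11 / 2 * (rho * l * W) by field.
have a8 : (rho * l + rho + L) * W = rho * l * W + rho * W + L * W by ring.
lra.
Qed.

Lemma online_sampling n d A r eps (E : list vec -> Prop) :
  (1 < d)%N -> is_rank n d A r -> 0 < eps <= 1 / 2 ->
  (forall S, spectral_approx n d A S eps -> (List.length S)%:R <=
    7 * ((r%:R * ln (mu n d A) + r%:R + ln d%:R) / eps ^+ 2 * ln d%:R) -> E S) ->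
  1 - 2 * exp (- (1 / 20) * ln d%:R) <= alg_prob n d A eps E.
Proof.
move=> d2 rk e02 HE; have [e0 e2] := andP e02.
have d0 : 0 < d%:R :> R by rewrite ltr0n ltnW.
set L := ln d%:R in HE *.
have expL : exp L = d%:R by apply: exp_lnK.
(* With [eps^2 <= 1/4] this gives [W >= 1], hence [c >= 1]. *)
have L4 : 1 / 4 <= L.
  apply: ler_exp_inv; rewrite expL.
  apply: le_trans (exp_le_inv _) _; first lra.
  apply: le_trans (_ : 2 <= _); last by rewrite ler_nat.
  by rewrite invf_ple ?posrE; lra.
have L0 : 0 < L by lra.
pose W := L / eps ^+ 2; pose c := c_param d eps.
have cW : c = 3 * W.
  by rewrite /c /c_param INRE -/L (_ : IZR 3 = 3%:R) ?RpowE ?RmultE ?RinvE /W; [ring | rewrite !RealsE].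
have ee : eps ^+ 2 <= 1 / 4 by rewrite expr2; nra.
have e20 : 0 < eps ^+ 2 by rewrite exprn_gt0.
have W1 : 1 <= W by rewrite /W ler_pdivlMr //; lra.
have c1 : 1 <= c by rewrite cW; lra.
have c0 : 0 < c by lra.
have cL : c * eps ^+ 2 = 3 * L by rewrite cW /W; field; rewrite gt_eqF.
have [s2 [b [s20 b0 sb ub lb]]] := spectrum_bounds n d A.
have [T iso] := isotropic_position (gram_prefix_sym d A n) (@gram_prefix_psd d A n).
have [k [mbig Bbig]] := potential_parameters L0 c0 e0 cL.
set th := 33 / 50 * (c * eps) in mbig Bbig; set xi := 11 / 25 * (th * eps) in mbig Bbig.
set m := (2 ^ k.+1)%N in mbig Bbig.
set B := (1 + (th * eps - xi) / m%:R) ^+ m in Bbig.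
have B0 : 0 < B by apply: lt_le_trans (exp_gt0 _) Bbig.
pose gam := 1 + 2 / (3 * c).
pose Inv i S := row_count_inv d A s2 gam i S /\ (i <= n)%N.
have kS i S : Inv i S -> forall z : 'cV_d, gram_prefix d A n *m z = 0 -> gram_seq d S *m z = 0.
  by case=> [[ker _] i_n] z /(gram_prefix_ker_mono i_n)/ker.
have th0 : 0 < th by rewrite /th; have := mulr_gt0 c0 e0; lra.
have the0 : 0 < th * eps by rewrite mulr_gt0.
have xi0 : 0 <= xi by rewrite /xi; lra.
have xe : xi <= th * eps by rewrite /xi; lra.
(* [Inv] holds surely, so [E] can fail only if the final potential has reached the threshold [B]. *)
apply: (@alg_prob_ge d eps A n E Inv (fun i S => Num.min 1 (potential A T m th xi i S / B))).
- move=> S IS nE; rewrite le_min lexx /= ler_pdivlMr // mul1r leNgt; apply/negP => pot.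
  apply: nE; have good x := potential_small_good x iso (leqnn n) (kS _ _ IS) xi0 th0 xe pot.
  have app : spectral_approx n d A S eps by apply: approx_of_quad => sg x; apply: good.
  apply: HE => //.
  have Sb (x : 'cV_d) : ip x (gram_seq d S *m x) <= 3 / 2 * b * ip x x.
    apply: le_trans (approx_quad app x) _.
    have := ub x; have := @gram_prefix_psd d A n x; set g := ip x (_ *m x) => g0 gb.
    have : (1 + eps) * g <= 3 / 2 * g by apply: ler_wpM2r => //; lra.
    rewrite -mulrA; lra.
  have [q [qr qA Sq]] := row_count_bound rk c0 s20 b0 (fun h => (sb h).1) IS.1 Sb.
  (* For [r = 0] the value of [mu] is unspecified, and the factor [r] removes it. *)
  have lmu : 0 <= r%:R * ln (mu n d A).
    case: (posnP r) => [->|r0]; first by rewrite mul0r.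
    have [[I [nd [lI [fI ind]]]] _] := rk.
    have Pn : prefix_nonzero n d A by apply: rows_indep_prefix_nonzero nd fI ind _; rewrite lI.
    have [sb1 muE] := sb Pn; apply: mulr_ge0; first exact: ler0n.
    have mu1 : 1 <= mu n d A by rewrite muE ler_pdivlMr // mul1r.
    by apply: ler_exp_inv; rewrite expR0 exp_lnK //; lra.
  have -> : (r%:R * ln (mu n d A) + r%:R + L) / eps ^+ 2 * L = (r%:R * ln (mu n d A) + r%:R + L) * W.
    by rewrite /W mulrAC -mulrA.
  set rho := r%:R in lmu *; have rho0 : 0 <= rho := ler0n _ _.
  have qrho : q%:R <= rho by rewrite ler_nat.
  set l := ln (mu n d A) in lmu *.
  have R0 : 0 <= (rho * l + rho + L) * W by rewrite mulr_ge0 //; lra.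
  case: (posnP q) => [q0|q0].
    by move: Sq; rewrite q0 !mul0r addr0 => Sq; apply: le_trans Sq _; lra.
  have [sb1 muE] := sb (qA q0).
  have mu1 : 1 <= mu n d A by rewrite muE ler_pdivlMr // mul1r.
  rewrite -muE in Sq; apply: row_count_le cW W1 (ltW L0) _ mu1 Sq.
  by rewrite ler0n.
- move=> S; rewrite le_min ler01 /= divr_ge0 ?(ltW B0) // /potential /m expnS mul2n.
  by rewrite addr_ge0 // trace_even_ge0 // potential_mx_sym.
- move=> i S i_n IS p; have [inv _] := IS.
  have [st1 st2] := row_count_step c1 e02 s20 i_n lb inv.
  have p01 : 0 <= p <= 1 by apply: samp_prob_range; apply: ltW.
  split=> //; [by move=> /st1 | by move=> /st2 |].
  apply: min1_supermartingale => // pot; rewrite ltr_pdivrMr // mul1r in pot.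
  have := potential_step erefl c0 e02 mbig iso i_n (kS _ _ IS) pot.
  have scale (x y z : R) : p * x + (1 - p) * y <= z -> p * (x / B) + (1 - p) * (y / B) <= z / B.
    by move=> h; rewrite (mulrA p) (mulrA (1 - p)) -mulrDl ler_pM2r // invr_gt0.
  exact: scale.
- by split=> //; apply: row_count_init.
- rewrite ge_min; apply/orP; right; rewrite potential_init -expL -mulrA ler_pM2l //.
  rewrite ler_pdivrMr //; apply: le_trans (_ : exp (- (1 / 20) * L) * exp (21 / 20 * L) <= _).
    by rewrite expRD RplusE; have -> : - (1 / 20) * L + 21 / 20 * L = L by field.
  by rewrite ler_pM2l ?exp_gt0.
Qed.

Open Scope R_scope.

Theorem mainTheorem1 :
  exists K C k : R, 0 < K /\ 0 < C /\ 0 < k /\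
  forall (n d : nat) (A : mat) (r : nat) (eps : R),
    is_rank n d A r ->
    0 < eps <= 1 / 2 ->
    alg_prob n d A eps
      (fun At => spectral_approx n d A At eps /\
         INR (length At) <=
           K * ((INR r * ln (mu n d A) + INR r + ln (INR d)) * / (eps ^ 2) * ln (INR d)))
    >= 1 - C * Rpower (INR d) (- k).
Proof.
(* 7 comes from [row_count_le], 2 from the two signs in the potential, and 1/20 from the excess of
   21/20 over 1. *)
exists 7, 2, (/ 20); split; [Lra.lra|split; [Lra.lra|split; [Lra.lra|]]].
move=> n d A r eps rk [/RltP e0 /RleP e2]; apply/Rle_ge/RleP.
have e02 : (0 < eps <= 1 / 2)%R.
  by rewrite e0 /=; move: e2; rewrite !RealsE.
set E := (fun At => _).
have expE : Rpower (INR d) (- / 20) = exp (- (1 / 20) * ln d%:R)%R.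
  by rewrite /Rpower INRE; congr exp; rewrite !RealsE mul1r.
have [d2|d1] := ltnP 1 d.
  have := @online_sampling n d A r eps E d2 rk e02 _.
  rewrite expE !RealsE; apply => S app lS; split=> //; apply/RleP.
  by rewrite !INRE !RealsE.
(* For [d <= 1] the logarithm is 0, with [ln 0 = 0] by default, and the claimed bound [1 - 2] is
   negative; it remains to see that the probability is nonnegative. *)
have -> : Rpower (INR d) (- / 20) = 1%R.
  rewrite expE; have -> : ln d%:R = 0%R; last by rewrite mulr0 expR0.
  case: d d1 {rk E expE} => [|[|//]] _; last exact: ln_1.
  by rewrite /ln; case: Rlt_dec => // h; case: (Rlt_irrefl 0).
have c0 : c_param d eps = 0%R.
  rewrite /c_param INRE; have -> : ln d%:R = 0%R; last by rewrite RmultE mulr0.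
  case: d d1 {rk E expE} => [|[|//]] _; last exact: ln_1.
  by rewrite /ln; case: Rlt_dec => // h; case: (Rlt_irrefl 0).
(* The constant [V = 1] gives nonnegativity, once the sampling probabilities are known to lie in
   [0, 1]. *)
have := @alg_prob_ge d eps A n E (fun _ _ => True) (fun _ _ => 1%R) 1%R.
case/(_ _ _ _ _ _)/wrap; rewrite ?ler01 //.
  move=> i S _ _ p; split=> //; last by rewrite !mulr1 subrKC.
  by apply: samp_prob_range; rewrite ?c0 // ltW.
move=> h; apply: le_trans h; rewrite (_ : IZR 2 = 2%:R)%R; last by rewrite !RealsE.
by rewrite RminusE RmultE mulr1 subrr subr_le0 ler1n.
Qed.
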